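(* Let $\mathcal D_{st}=(D,<_{st},\rho)$ and $\mathcal D_{wk}=(D,<_{wk},\rho)$ be two computable partially ordered sets on the same set $D$ such that $<_{st}$ extends $<_{wk}$ (i.e. $d<_{wk}e\Rightarrow d<_{st}e$). 1. Suppose condition $( * )$ holds: for every $k$ there exists a $<_{st}$-chain with $k$ elements which is a $<_{wk}$-antichain. Then $K^{\mathcal D_{st}}_{\max}<_{ct}K^{\mathcal D_{wk}}_{\max}$ and $K^{\mathcal D_{st}}_{\min}<_{ct}K^{\mathcal D_{wk}}_{\min}$. More strongly, for every total computable $\alpha:\mathbb N\to\mathbb N$ the sets $\{d\in D:\inf(K^{\mathcal D_{wk}}_{\min}(d),K^{\mathcal D_{wk}}_{\max}(d))\ge\alpha(K^{\mathcal D_{st}}_{\max}(d))\}$ and $\{d\in D:\inf(K^{\mathcal D_{wk}}_{\min}(d),K^{\mathcal D_{wk}}_{\max}(d))\ge\alpha(K^{\mathcal D_{st}}_{\min}(d))\}$ are infinite. 2. Suppose condition $( ** )$ holds: there exists $k$ such that for every partial computable $f:\{0,1\}^*\times\mathbb N\to D$ which is monotone increasing in its second argument with respect to $<_{st}$, there exist partial computable $f_1,\dots,f_k:\{0,1\}^*\times\mathbb N\to D$ monotone increasing in their second argument with respect to $<_{wk}$ such that for every $p$, $\{f(p,t):t\in\mathbb N\}=\bigcup_{i=1}^k\{f_i(p,t):t\in\mathbb N\}$ (sets of defined values). Then $K^{\mathcal D_{st}}_{\min}=_{ct}K^{\mathcal D_{wk}}_{\min}$ and $K^{\mathcal D_{st}}_{\max}=_{ct}K^{\mathcal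 D_{wk}}_{\max}$.
   Context: A computable partially ordered set is a triple $\mathcal D=(D,<,\rho)$ where $\rho:\mathbb N\to D$ is a bijection and $<$ is a strict partial order on $D$ with $\{(m,n):\rho(m)<\rho(n)\}$ computable; a partial function into $D$ is partial (resp. total) computable if its composition with $\rho^{-1}$ is. ''Monotone increasing in the second argument'' for a partial $f$ means monotone on its domain. For such $f:\{0,1\}^*\times\mathbb N\to D$, $\max^{\mathcal D}f$ is the partial function defined exactly at those $p$ for which $\{f(p,t):t\in\mathbb N,\ f(p,t)\text{ defined}\}$ is finite and non-empty, with value its maximum element. $\mathrm{Max}_{\mathrm{PR}}[\{0,1\}^*\to\mathcal D]$ is the class of all $\max^{\mathcal D}f$ with $f$ partial computable and monotone increasing in its second argument. For partial $\varphi:\{0,1\}^*\to D$, $K_\varphi(d)=\min\{|p|:\varphi(p)=d\}$. $K^{\mathcal D}_{\max}$ is $K_U$ for some $U\in\mathrm{Max}_{\mathrm{PR}}[\{0,1\}^*\to\mathcal D]$ optimal in that class (for every $F$ in the class there is $c$ with $K_U(d)\le K_F(d)+c$ whenever $K_F(d)$ is defined; such $U$ exists), and $K^{\mathcal D}_{\min}$ is $K^{\mathcal D'}_{\max}$ for the reverse order $\mathcal D'=(D,>,\rho)$; both are total functions $D\to\mathbb N$ defined up to an additive constant. $f\le_{ct}g$ iff $\exists c\,\forall d\ f(d)\le g(d)+c$; $f=_{ct}g$ iff both $f\le_{ct}g$ and $g\le_{ct}f$; $f<_{ct}g$ iff $f\le_{ct}g$ and not $g\le_{ct}f$. *)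

(* Defs.v *)
From Stdlib Require Import List Arith ClassicalEpsilon.
Import ListNotations.

Inductive code : Type :=
| CZero : code
| CSucc : code
| CProj : nat -> code                (* i-th argument (0 if out of range) *)
| CComp : code -> list code -> code
| CPrec : code -> code -> code
| CMu   : code -> code.

Inductive eval : code -> list nat -> nat -> Prop :=
| ev_zero xs : eval CZero xs 0
| ev_succ x xs : eval CSucc (x :: xs) (S x)
| ev_proj i xs : eval (CProj i) xs (nth i xs 0)
| ev_comp f gs xs ys y : evals gs xs ys -> eval f ys y -> eval (CComp f gs) xs y
| ev_prec0 f g xs y : eval f xs y -> eval (CPrec f g) (0 :: xs) y
| ev_precS f g n xs r y :
    eval (CPrec f g) (n :: xs) r -> eval g (n :: r :: xs) y ->
    eval (CPrec f g) (S n :: xs) y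
| ev_mu f xs n :
    eval f (n :: xs) 0 ->
    (forall m, m < n -> exists k, eval f (m :: xs) (S k)) ->
    eval (CMu f) xs n
with evals : list code -> list nat -> list nat -> Prop :=
| evs_nil xs : evals [] xs []
| evs_cons g gs xs y ys : eval g xs y -> evals gs xs ys -> evals (g :: gs) xs (y :: ys).

(** Bijective base-2 encoding of binary strings {0,1}^* into nat. *)
Definition enc_bits (p : list bool) : nat :=
  fold_left (fun n (b : bool) => 2 * n + (if b then 2 else 1)) p 0.

Definition total_computable (a : nat -> nat) : Prop :=
  exists c, forall n y, eval c [n] y <-> a n = y.

Definition bijective_enum {D : Type} (rho : nat -> D) : Prop :=
  (forall m n, rho m = rho n -> m = n) /\ (forall d, exists n, rho n = d).

Definition computable_spo {D : Type} (rho : nat -> D) (lt : D -> D -> Prop) : Prop :=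
  bijective_enum rho /\
  (forall d, ~ lt d d) /\
  (forall d e f, lt d e -> lt e f -> lt d f) /\
  (exists c, forall m n y,
      eval c [m; n] y <-> ((y = 1 /\ lt (rho m) (rho n)) \/ (y = 0 /\ ~ lt (rho m) (rho n)))).

Definition rev_order {D : Type} (lt : D -> D -> Prop) : D -> D -> Prop :=
  fun x y => lt y x.

(** Partial computable f : {0,1}^* x N -> D (via rho^{-1}); None = undefined. *)
Definition partial_computable2 {D : Type} (rho : nat -> D)
  (f : list bool -> nat -> option D) : Prop :=
  exists c, forall p t y, eval c [enc_bits p; t] y <-> f p t = Some (rho y).

Definition monotone2 {D : Type} (lt : D -> D -> Prop)
  (f : list bool -> nat -> option D) : Prop :=
  forall p t1 t2 d1 d2, t1 <= t2 -> f p t1 = Some d1 -> f p t2 = Some d2 ->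
    d1 = d2 \/ lt d1 d2.

Definition is_max_value {D : Type} (lt : D -> D -> Prop)
  (f : list bool -> nat -> option D) (p : list bool) (d : D) : Prop :=
  (exists l : list D, forall e, (exists t, f p t = Some e) -> In e l) /\
  (exists t, f p t = Some d) /\
  (forall t e, f p t = Some e -> e = d \/ lt e d).

Definition is_max_of {D : Type} (lt : D -> D -> Prop)
  (f : list bool -> nat -> option D) (phi : list bool -> option D) : Prop :=
  forall p d, phi p = Some d <-> is_max_value lt f p d.

Definition MaxPR {D : Type} (rho : nat -> D) (lt : D -> D -> Prop)
  (phi : list bool -> option D) : Prop :=
  exists f, partial_computable2 rho f /\ monotone2 lt f /\ is_max_of lt f phi.

Definition Kdef {D : Type} (phi : list bool -> option D) (d : D) : Prop :=
  exists p, phi p = Some d.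

Definition K_spec {D : Type} (phi : list bool -> option D) (d : D) (n : nat) : Prop :=
  (exists p, phi p = Some d /\ length p = n) /\
  (forall p, phi p = Some d -> n <= length p).

(** Its value (meaningful when Kdef phi d holds). *)
Definition K {D : Type} (phi : list bool -> option D) (d : D) : nat :=
  epsilon (inhabits 0) (K_spec phi d).

Definition optimal_max {D : Type} (rho : nat -> D) (lt : D -> D -> Prop)
  (U : list bool -> option D) : Prop :=
  MaxPR rho lt U /\
  forall F, MaxPR rho lt F ->
    exists c, forall d, Kdef F d -> Kdef U d /\ K U d <= K F d + c.

Definition le_ct {D : Type} (f g : D -> nat) : Prop :=
  exists c, forall d, f d <= g d + c.
Definition eq_ct {D : Type} (f g : D -> nat) : Prop := le_ct f g /\ le_ct g f.
Definition lt_ct {D : Type} (f g : D -> nat) : Prop := le_ct f g /\ ~ le_ct g f.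

Definition infinite_set {D : Type} (P : D -> Prop) : Prop :=
  ~ exists l : list D, forall d, P d -> In d l.

Definition cond_star {D : Type} (st wk : D -> D -> Prop) : Prop :=
  forall k, exists l : list D,
    length l = k /\ NoDup l /\
    (forall x y, In x l -> In y l -> x <> y -> st x y \/ st y x) /\
    (forall x y, In x l -> In y l -> ~ wk x y).

Definition cond_starstar {D : Type} (rho : nat -> D) (st wk : D -> D -> Prop) : Prop :=
  exists k, forall f, partial_computable2 rho f -> monotone2 st f ->
    exists fs : list (list bool -> nat -> option D),
      length fs = k /\
      (forall g, In g fs -> partial_computable2 rho g /\ monotone2 wk g) /\
      (forall p e, (exists t, f p t = Some e) <->
                   (exists g, In g fs /\ exists t, g p t = Some e)).

(* Main.v *)
(** Part 1.  A program enumerating a wk-monotone sequence meets a given wk-antichain at most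
    once.  So if an st-chain which is a wk-antichain has more than 2 * 2^m elements, one of
    them is never produced by a program of length < m, neither for the max nor for the min
    complexity of wk.  The st-least element not produced so far increases with time along the
    chain, and its limit has small st-complexity since the chain is computed from m.

    Part 2.  Condition (star star) bounds by some k the size of the wk-antichains contained in
    an st-chain, a condition invariant under reversal of both orders.  The values of an
    st-monotone enumeration, without those found too late to be st-above the earlier ones,
    arrive along a linear extension of wk, so each is wk-maximal on arrival, and the on-line algorithm of Agarwal and Garg distributes
    the values over k (k + 1) / 2 wk-chains.  Each chain is enumerated by a wk-monotone
    function, and one of these functions ends at the maximum. *)

Require Import Defs.
From Stdlib Require Import List Arith Lia Classical ClassicalEpsilon Cantor Sorted FinFun.
Import ListNotations.

(** A partial computable function is seen only through a dovetailed search, so its values arrive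
    repeated and out of order. Part 1 is insensitive to this, since having been produced is a
    property that only becomes true with time. Part 2 pays for it by discarding late values: the
    maximum is never late, and it is the only value that has to survive.

    In part 1 one machine serves all programs, so its optimality constant is fixed before the
    program is chosen. A program coded by n costs at most n bits for st, while all wk-programs with
    code below [2 ^ gap n] are avoided, and [gap] may be any total computable function.

    In part 2 the number k (k + 1) / 2 comes from levels 1 to k, level i holding i chains whose last
    elements form an antichain. Level k can never refuse a value, since its k last elements and that
    value would be an antichain exceeding the width. Which chain ends at the maximum depends on the
    program, but there are only finitely many chains, hence finitely many constants. *)

Fixpoint code_nested_ind (P : code -> Prop)
  (Hzero : P CZero) (Hsucc : P CSucc) (Hproj : forall i, P (CProj i))
  (Hcomp : forall f gs, P f -> Forall P gs -> P (CComp f gs))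
  (Hprec : forall f g, P f -> P g -> P (CPrec f g))
  (Hmu : forall f, P f -> P (CMu f)) (c : code) : P c :=
  let rec := code_nested_ind P Hzero Hsucc Hproj Hcomp Hprec Hmu in
  match c with
  | CZero => Hzero
  | CSucc => Hsucc
  | CProj i => Hproj i
  | CComp f gs =>
      Hcomp f gs (rec f)
        ((fix all l : Forall P l :=
            match l with
            | [] => Forall_nil P
            | g :: l' => Forall_cons g (rec g) (all l')
            end) gs)
  | CPrec f g => Hprec f g (rec f) (rec g)
  | CMu f => Hmu f (rec f)
  end.

(** * Step-bounded evaluation *)

(* Partial values are coded in [nat]: [0] is undefined and [S y] is the value [y].
   In the search for a zero, the state is [0] while searching, [1] after a failure,
   and [S (S n)] once [n] is found. *)
Fixpoint run (c : code) (w : nat) (v : list nat) : nat :=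
  match c with
  | CZero => 1
  | CSucc => match v with [] => 0 | x :: _ => S (S x) end
  | CProj i => S (nth i v 0)
  | CComp f gs =>
      if forallb (fun g => negb (run g w v =? 0)) gs
      then run f w (map (fun g => pred (run g w v)) gs) else 0
  | CPrec f g =>
      match v with
      | [] => 0
      | n :: xs =>
          nat_rect (fun _ => nat) (run f w xs)
            (fun i r => if r =? 0 then 0 else run g w (i :: pred r :: xs)) n
      end
  | CMu f =>
      pred (nat_rect (fun _ => nat) 0
        (fun i r => if r =? 0
                    then (if run f w (i :: v) =? 0 then 1
                          else if run f w (i :: v) =? 1 then S (S i) else 0)
                    else r) w)
  end.

Lemma run_sound c : forall w v y, run c w v = S y -> eval c v y.
Proof.
  induction c as [| |i|f gs IHf IHgs|f g IHf IHg|f IHf] using code_nested_ind;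
    intros w v y; cbn [run].
  - intros [= <-]. constructor.
  - destruct v; [discriminate|]. intros [= <-]. constructor.
  - intros [= <-]. constructor.
  - destruct (forallb _ gs) eqn:Hall; [|discriminate].
    intros Hf. apply ev_comp with (map (fun g => pred (run g w v)) gs); [|eauto].
    clear IHf Hf. induction IHgs as [|g gs Hg _ IH]; simpl in *; constructor.
    + apply andb_prop in Hall as [Hg0 _]. apply Hg with w.
      destruct (run g w v); [discriminate|reflexivity].
    + apply IH. now apply andb_prop in Hall.
  - destruct v as [|n xs]; [discriminate|].
    revert y. induction n as [|n IHn]; simpl; intros y.
    + intros H. constructor. eauto.
    + destruct (nat_rect _ _ _ n) as [|r] eqn:Hr; [discriminate|]. simpl.
      intros H. apply ev_precS with r; eauto.
  (* Loop invariant of the search: state 0 certifies that all candidates tried have positive values,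
     [S (S n)] certifies the answer n, and the absorbing state 1 claims nothing. *)
  - assert (Hinv : forall b,
      let r := nat_rect (fun _ => nat) 0
        (fun i r => if r =? 0
                    then (if run f w (i :: v) =? 0 then 1
                          else if run f w (i :: v) =? 1 then S (S i) else 0)
                    else r) b in
      (r = 0 -> forall m, m < b -> exists k, eval f (m :: v) (S k)) /\
      (forall n, r = S (S n) -> eval (CMu f) v n)).
    { induction b as [|b [IH0 IHS]]; simpl; [split; [lia|discriminate]|].
      set (r := nat_rect _ _ _ b) in *. clearbody r.
      destruct r as [|r]; simpl; [|split; [discriminate|exact IHS]].
      destruct (run f w (b :: v)) as [|[|k]] eqn:Hb; simpl.
      - split; [discriminate|]. intros n [=].
      - split; [discriminate|]. intros n [= <-]. constructor; eauto.
      - split; [|discriminate]. intros _ m Hm.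
        assert (m < b \/ m = b) as [Hlt| ->] by lia; eauto. }
    specialize (Hinv w). cbv zeta in Hinv. set (r := nat_rect _ _ _ w) in *.
    (* The outer [pred] sends the states 0 and 1 to undefined, so a defined result comes from a
       state [S (S y)]. *)
    intros Hy. apply Hinv. lia.
Qed.

Lemma eventually_below (P : nat -> nat -> Prop) n :
  (forall m, m < n -> exists w0, forall w, w0 <= w -> P m w) ->
  exists w0, forall w, w0 <= w -> forall m, m < n -> P m w.
Proof.
  induction n as [|n IH]; intros H; [exists 0; lia|].
  destruct IH as [w1 H1]; [auto|]. destruct (H n) as [w2 H2]; [lia|].
  exists (w1 + w2). intros w Hw m Hm.
  assert (m < n \/ m = n) as [?| ->] by lia; [apply H1|apply H2]; lia.
Qed.

(** Only the search in [CMu] consults the budget [w]. A derivation uses finitely many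
    subcomputations, so the sum of their thresholds is a threshold for the whole. *)
Lemma run_complete c : forall v y,
  eval c v y -> exists w0, forall w, w0 <= w -> run c w v = S y.
Proof.
  induction c as [| |i|f gs IHf IHgs|f g IHf IHg|f IHf] using code_nested_ind;
    intros v y H.
  - inversion H; subst. now exists 0.
  - inversion H; subst. now exists 0.
  - inversion H; subst. now exists 0.
  - inversion H as [| | |f' gs' v' ys y' Hgs Hf| | |]; subst.
    assert (Hmap : exists w0, forall w, w0 <= w ->
                     map (fun g => run g w v) gs = map S ys).
    { clear - IHgs Hgs. revert ys Hgs.
      induction IHgs as [|g gs Hg _ IH]; intros ys Hgs; inversion Hgs; subst.
      - now exists 0.
      - edestruct Hg as [w1 E1]; [eassumption|].
        edestruct IH as [w2 E2]; [eassumption|].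
        exists (w1 + w2). intros w Hw. simpl. rewrite E1, E2 by lia. reflexivity. }
    destruct Hmap as [w1 H1]. destruct (IHf _ _ Hf) as [w2 H2].
    exists (w1 + w2). intros w Hw. cbn [run].
    specialize (H1 w ltac:(lia)). specialize (H2 w ltac:(lia)).
    replace (forallb _ gs) with true.
    + replace (map _ gs) with ys; [exact H2|].
      apply (f_equal (map pred)) in H1. rewrite !map_map in H1. simpl in H1.
      now rewrite map_id in H1.
    + clear - H1. symmetry. revert ys H1.
      induction gs as [|g gs IH]; intros [|y ys] H1; try discriminate; [reflexivity|].
      simpl in *. injection H1 as Hg Hgs. rewrite Hg. simpl. eauto.
  - destruct v as [|n xs]; [inversion H|].
    revert y H. induction n as [|n IHn]; intros y H; inversion H; subst.
    + edestruct IHf as [w1 E1]; [eassumption|]. exists w1. intros w Hw. cbn. auto.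
    + edestruct IHn as [w1 E1]; [eassumption|].
      edestruct IHg as [w2 E2]; [eassumption|].
      exists (w1 + w2). intros w Hw.
      specialize (E1 w ltac:(lia)). cbn in E1 |- *. rewrite E1. cbn.
      apply E2. lia.
  - inversion H as [| | | | | |f' v' n Hn Hlow]; subst. rename y into n.
    destruct (IHf _ _ Hn) as [w1 H1].
    destruct (eventually_below (fun m w => exists k, run f w (m :: v) = S (S k)) n)
      as [w2 H2].
    { intros m Hm. destruct (Hlow m Hm) as [k Hk].
      destruct (IHf _ _ Hk) as [w2 H2]. exists w2. eauto. }
    (* The summand [S n] lets the loop reach candidate n; from then on the state is absorbed. *)
    exists (w1 + w2 + S n). intros w Hw. cbn [run].
    set (G := fun i r : nat => _).
    assert (Hbelow : forall b, b <= n -> nat_rect (fun _ => nat) 0 G b = 0).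
    { induction b as [|b IH]; intros Hb; [reflexivity|]. cbn [nat_rect].
      rewrite IH by lia. unfold G. simpl.
      destruct (H2 w ltac:(lia) b ltac:(lia)) as [k ->]. reflexivity. }
    assert (Habove : forall b, nat_rect (fun _ => nat) 0 G (b + S n) = S (S n)).
    { induction b as [|b IH]; simpl.
      - rewrite Hbelow by lia. unfold G. rewrite H1 by lia. reflexivity.
      - now rewrite IH. }
    replace (nat_rect _ _ _ w) with (S (S n)); [reflexivity|].
    now replace w with ((w - S n) + S n) by lia.
Qed.

(** Two derivations agree with the same value of the function [run] once the budget is large; this
    replaces a mutual induction on [eval] and [evals]. *)
Lemma eval_functional c v y1 y2 : eval c v y1 -> eval c v y2 -> y1 = y2.
Proof.
  intros H1 H2. destruct (run_complete _ _ _ H1) as [w1 E1].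
  destruct (run_complete _ _ _ H2) as [w2 E2].
  specialize (E1 (w1 + w2) ltac:(lia)). specialize (E2 (w1 + w2) ltac:(lia)). congruence.
Qed.

(** * Total recursive functions *)

(** Functions take the whole argument list, so that expressions built from [nth] and [tl] can be
    treated by syntax-directed closure lemmas. The arity is fixed because substitution has to list
    the projections explicitly. *)
Definition recursive (n : nat) (F : list nat -> nat) : Prop :=
  exists c, forall v, length v = n -> eval c v (F v).

Notation decidable_rec n P := (recursive n (fun v => Nat.b2n (P v))).

Create HintDb rec.

Lemma recursive_ext n F G :
  (forall v, length v = n -> F v = G v) -> recursive n F -> recursive n G.
Proof. intros E [c Hc]. exists c. intros v Hv. rewrite <- E; auto. Qed.

Lemma recursive_var n i : recursive n (fun v => nth i v 0).
Proof. exists (CProj i). constructor. Qed.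

Lemma nth_tl (i : nat) (v : list nat) : nth i (tl v) 0 = nth (S i) v 0.
Proof. destruct v; [now destruct i|reflexivity]. Qed.

(** Under a binder the old context appears as a [tl] of the new one; this turns a shifted variable
    back into a plain projection. *)
Lemma recursive_var_tl n i T :
  recursive n (fun v => nth (S i) (T v) 0) -> recursive n (fun v => nth i (tl (T v)) 0).
Proof. apply recursive_ext. intros v _. now rewrite nth_tl. Qed.

Lemma evals_recursive n Fs :
  Forall (recursive n) Fs ->
  exists gs, forall v, length v = n -> evals gs v (map (fun F => F v) Fs).
Proof.
  induction 1 as [|F Fs [c Hc] _ [gs Hgs]].
  - exists []. constructor.
  - exists (c :: gs). intros v Hv. constructor; auto.
Qed.

Lemma recursive_comp n F Gs :
  recursive (length Gs) F -> Forall (recursive n) Gs ->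
  recursive n (fun v => F (map (fun G => G v) Gs)).
Proof.
  intros [c Hc] HGs. destruct (evals_recursive _ _ HGs) as [gs Hgs].
  exists (CComp c gs). intros v Hv. econstructor; [now apply Hgs|].
  apply Hc. now rewrite length_map.
Qed.

Lemma recursive_app1 f :
  recursive 1 (fun v => f (nth 0 v 0)) ->
  forall n A, recursive n A -> recursive n (fun v => f (A v)).
Proof. intros Hf n A HA. apply (recursive_comp n _ [A] Hf). auto. Qed.

Lemma recursive_app2 f :
  recursive 2 (fun v => f (nth 0 v 0) (nth 1 v 0)) ->
  forall n A B, recursive n A -> recursive n B -> recursive n (fun v => f (A v) (B v)).
Proof. intros Hf n A B HA HB. apply (recursive_comp n _ [A; B] Hf). auto. Qed.

Lemma recursive_app3 f :
  recursive 3 (fun v => f (nth 0 v 0) (nth 1 v 0) (nth 2 v 0)) ->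
  forall n A B C, recursive n A -> recursive n B -> recursive n C ->
    recursive n (fun v => f (A v) (B v) (C v)).
Proof. intros Hf n A B C HA HB HC. apply (recursive_comp n _ [A; B; C] Hf). auto. Qed.

Lemma recursive_S n A : recursive n A -> recursive n (fun v => S (A v)).
Proof.
  apply (recursive_app1 S). exists CSucc. intros [|x v] Hv; [discriminate|]. constructor.
Qed.

Lemma recursive_const n k : recursive n (fun _ => k).
Proof.
  induction k as [|k IH]; [exists CZero; constructor|]. now apply recursive_S.
Qed.

Lemma map_nth_seq (v : list nat) (d : nat) : map (fun i => nth i v d) (seq 0 (length v)) = v.
Proof.
  apply nth_ext with d d; rewrite length_map, length_seq; [reflexivity|].
  intros i Hi. rewrite nth_indep with (d' := nth 0 v d) by now rewrite length_map, length_seq.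
  rewrite (map_nth (fun i => nth i v d)), seq_nth by assumption. reflexivity.
Qed.

Lemma map_nth_seq_skipn (v : list nat) (d j n : nat) :
  length v = j + n -> map (fun i => nth i v d) (seq j n) = skipn j v.
Proof.
  revert v. induction j as [|j IH]; intros v Hv.
  - simpl in Hv. subst n. apply map_nth_seq.
  - destruct v as [|x v]; [discriminate|]. injection Hv as Hv.
    rewrite <- seq_shift, map_map. now apply IH.
Qed.

(** Substitution and weakening at once: the first j variables are dropped and new expressions put
    before the remaining ones. [T] stays abstract because in use it is an iterated [tl]. *)
Lemma recursive_subst n j F Gs T :
  (forall v, length v = j + n -> T v = skipn j v) ->
  recursive (length Gs + n) F -> Forall (recursive (j + n)) Gs ->
  recursive (j + n) (fun v => F (map (fun G => G v) Gs ++ T v)).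
Proof.
  intros HT HF HGs.
  apply recursive_ext with
    (fun v => F (map (fun G => G v) (Gs ++ map (fun i v => nth i v 0) (seq j n)))).
  - intros v Hv. rewrite HT, map_app, map_map by assumption. do 2 f_equal.
    now rewrite map_nth_seq_skipn.
  - apply recursive_comp; [now rewrite length_app, length_map, length_seq|].
    apply Forall_app. split; [assumption|]. apply Forall_map, Forall_forall.
    intros i _. apply recursive_var.
Qed.

Lemma recursive_prec n F G A :
  recursive n F -> recursive n A ->
  recursive (S (S n)) (fun w => G (nth 0 w 0) (nth 1 w 0) (tl (tl w))) ->
  recursive n (fun v => nat_rect (fun _ => nat) (F v) (fun i r => G i r v) (A v)).
Proof.
  intros [cF HF] HA [cG HG].
  (* [CPrec] recurses on its first argument, so the function with an additional leading bound is
     treated first and [A] is substituted for that bound. *)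
  apply (recursive_subst n 0 (fun w => nat_rect (fun _ => nat) (F (tl w))
           (fun i r => G i r (tl w)) (nth 0 w 0)) [A] (fun v => v)); [reflexivity| |auto].
  exists (CPrec cF cG). intros [|x v] Hv; [discriminate|]. injection Hv as Hv. cbn [nth tl].
  induction x as [|x IH]; simpl; [constructor; auto|].
  apply ev_precS with (1 := IH).
  apply (HG (x :: _ :: v)). simpl. auto.
Qed.

#[local] Hint Resolve recursive_S recursive_const recursive_var recursive_var_tl : rec.
Ltac recursive := cbn [Nat.add nth]; auto 40 with rec.

Lemma recursive_add n A B :
  recursive n A -> recursive n B -> recursive n (fun v => A v + B v).
Proof.
  intros HA HB.
  apply recursive_ext with
    (fun v => nat_rect (fun _ => nat) (B v) (fun _ r => S r) (A v)).
  - intros v _. induction (A v); simpl; congruence.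
  - apply recursive_prec; recursive.
Qed.

Lemma recursive_pred n A : recursive n A -> recursive n (fun v => pred (A v)).
Proof.
  intros HA.
  apply recursive_ext with (fun v => nat_rect (fun _ => nat) 0 (fun i _ => i) (A v)).
  - intros v _. now destruct (A v).
  - apply recursive_prec; recursive.
Qed.
#[local] Hint Resolve recursive_add recursive_pred : rec.

Lemma recursive_sub n A B :
  recursive n A -> recursive n B -> recursive n (fun v => A v - B v).
Proof.
  intros HA HB.
  apply recursive_ext with
    (fun v => nat_rect (fun _ => nat) (A v) (fun _ r => pred r) (B v)).
  - intros v _. induction (B v); simpl; lia.
  - apply recursive_prec; recursive.
Qed.

Lemma recursive_mul n A B :
  recursive n A -> recursive n B -> recursive n (fun v => A v * B v).
Proof.
  apply (recursive_app2 Nat.mul).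
  apply recursive_ext with
    (fun v => nat_rect (fun _ => nat) 0 (fun _ r => nth 1 v 0 + r) (nth 0 v 0)).
  - intros v _. induction (nth 0 v 0); simpl; congruence.
  - apply recursive_prec; recursive.
Qed.
#[local] Hint Resolve recursive_sub recursive_mul : rec.

Lemma recursive_pow n A B :
  recursive n A -> recursive n B -> recursive n (fun v => A v ^ B v).
Proof.
  apply (recursive_app2 Nat.pow).
  apply recursive_ext with
    (fun v => nat_rect (fun _ => nat) 1 (fun _ r => nth 0 v 0 * r) (nth 1 v 0)).
  - intros v _. induction (nth 1 v 0); simpl; congruence.
  - apply recursive_prec; recursive.
Qed.

Lemma recursive_ifzero n A B C :
  recursive n A -> recursive n B -> recursive n C ->
  recursive n (fun v => if A v =? 0 then B v else C v).
Proof.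
  intros HA HB HC.
  apply recursive_ext with (fun v => (1 - A v) * B v + (1 - (1 - A v)) * C v).
  - intros v _. destruct (A v); simpl; lia.
  - recursive.
Qed.

Lemma recursive_if n P B C :
  decidable_rec n P -> recursive n B -> recursive n C ->
  recursive n (fun v => if P v then B v else C v).
Proof.
  intros HP HB HC.
  apply recursive_ext with (fun v => if Nat.b2n (P v) =? 0 then C v else B v).
  - intros v _. now destruct (P v).
  - now apply recursive_ifzero.
Qed.
#[local] Hint Resolve recursive_pow recursive_ifzero recursive_if : rec.

Lemma decidable_leb n A B :
  recursive n A -> recursive n B -> decidable_rec n (fun v => A v <=? B v).
Proof.
  intros HA HB. apply recursive_ext with (fun v => 1 - (A v - B v)); [|recursive].
  intros v _. destruct (Nat.leb_spec (A v) (B v)); cbn [Nat.b2n]; lia.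
Qed.

Lemma decidable_negb n P : decidable_rec n P -> decidable_rec n (fun v => negb (P v)).
Proof.
  intros HP. apply recursive_ext with (fun v => 1 - Nat.b2n (P v)); [|recursive].
  intros v _. now destruct (P v).
Qed.

Lemma decidable_andb n P Q :
  decidable_rec n P -> decidable_rec n Q -> decidable_rec n (fun v => P v && Q v)%bool.
Proof.
  intros HP HQ. apply recursive_ext with (fun v => Nat.b2n (P v) * Nat.b2n (Q v)); [|recursive].
  intros v _. now destruct (P v), (Q v).
Qed.
#[local] Hint Resolve decidable_leb decidable_negb decidable_andb : rec.

Lemma decidable_orb n P Q :
  decidable_rec n P -> decidable_rec n Q -> decidable_rec n (fun v => P v || Q v)%bool.
Proof.
  intros HP HQ.
  apply recursive_ext with (fun v => Nat.b2n (negb (negb (P v) && negb (Q v)))); [|recursive].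
  intros v _. now destruct (P v), (Q v).
Qed.

Lemma decidable_ltb n A B :
  recursive n A -> recursive n B -> decidable_rec n (fun v => A v <? B v).
Proof. intros HA HB. unfold Nat.ltb. recursive. Qed.

Lemma decidable_eqb n A B :
  recursive n A -> recursive n B -> decidable_rec n (fun v => A v =? B v).
Proof.
  intros HA HB.
  apply recursive_ext with (fun v => Nat.b2n ((A v <=? B v) && (B v <=? A v))); [|recursive].
  intros v _. destruct (Nat.leb_spec (A v) (B v)), (Nat.leb_spec (B v) (A v)),
    (Nat.eqb_spec (A v) (B v)); simpl; lia.
Qed.
#[local] Hint Resolve decidable_orb decidable_ltb decidable_eqb : rec.

Lemma tl_tl (n : nat) (w : list nat) : length w = 2 + n -> tl (tl w) = skipn 2 w.
Proof. now destruct w as [|x [|y w]]. Qed.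

Lemma recursive_sum n F A :
  recursive n A -> recursive (S n) (fun w => F (nth 0 w 0) (tl w)) ->
  recursive n (fun v => list_sum (map (fun i => F i v) (seq 0 (A v)))).
Proof.
  intros HA HF.
  apply recursive_ext with
    (fun v => nat_rect (fun _ => nat) 0 (fun i r => r + F i v) (A v)).
  - intros v _. induction (A v) as [|a IH]; [reflexivity|].
    rewrite seq_S, map_app, list_sum_app. simpl. rewrite IH. lia.
  - apply recursive_prec; [recursive|recursive|].
    apply recursive_add; [recursive|].
    apply (recursive_subst n 2 _ [fun w => nth 0 w 0] (fun w => tl (tl w)) (tl_tl n) HF).
    recursive.
Qed.

Lemma decidable_existsb n P A :
  recursive n A -> decidable_rec (S n) (fun w => P (nth 0 w 0) (tl w)) ->
  decidable_rec n (fun v => existsb (fun i => P i v) (seq 0 (A v))).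
Proof.
  intros HA HP.
  apply recursive_ext with
    (fun v => Nat.b2n (0 <? list_sum (map (fun i => Nat.b2n (P i v)) (seq 0 (A v))))).
  - intros v _. f_equal. induction (seq 0 (A v)) as [|i l IH]; [reflexivity|].
    simpl. now destruct (P i v).
  - pose proof (recursive_sum n (fun i v => Nat.b2n (P i v)) A HA HP). recursive.
Qed.

Lemma decidable_forallb n P A :
  recursive n A -> decidable_rec (S n) (fun w => P (nth 0 w 0) (tl w)) ->
  decidable_rec n (fun v => forallb (fun i => P i v) (seq 0 (A v))).
Proof.
  intros HA HP.
  apply recursive_ext with
    (fun v => Nat.b2n (negb (existsb (fun i => negb (P i v)) (seq 0 (A v))))).
  - intros v _. f_equal. induction (seq 0 (A v)) as [|i l IH]; [reflexivity|].
    simpl. now destruct (P i v).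
  - apply decidable_negb.
    apply (decidable_existsb n (fun i v => negb (P i v))); [assumption|].
    now apply decidable_negb with (P := fun w => P (nth 0 w 0) (tl w)).
Qed.
#[local] Hint Resolve recursive_sum decidable_existsb decidable_forallb : rec.

(** With [epsilon] the search is a total function of [P] and can occur in any expression. A witness
    gives it meaning, and the same witness makes the corresponding [CMu] halt. *)
Definition least (P : nat -> bool) : nat :=
  epsilon (inhabits 0) (fun n => P n = true /\ forall m, m < n -> P m = false).

Lemma least_witness (P : nat -> bool) :
  (exists n, P n = true) -> exists n, P n = true /\ forall m, m < n -> P m = false.
Proof.
  intros [n Hn]. induction n as [n IH] using lt_wf_ind.
  destruct (existsb P (seq 0 n)) eqn:E.
  - apply existsb_exists in E as (m & Hm & HP). apply in_seq in Hm. apply (IH m); [lia|auto].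
  - exists n. split; [assumption|]. intros m Hm. destruct (P m) eqn:HP; [|reflexivity].
    rewrite <- E. symmetry. apply existsb_exists. exists m. split; [apply in_seq; lia|auto].
Qed.

Lemma least_spec (P : nat -> bool) : (exists n, P n = true) -> P (least P) = true.
Proof.
  intros H. apply (epsilon_spec (inhabits 0) _ (least_witness P H)).
Qed.

Lemma least_minimal (P : nat -> bool) m :
  (exists n, P n = true) -> m < least P -> P m = false.
Proof.
  intros H. now apply (epsilon_spec (inhabits 0) _ (least_witness P H)).
Qed.

Lemma recursive_least n P :
  decidable_rec (S n) (fun w => P (nth 0 w 0) (tl w)) ->
  (forall v, length v = n -> exists i, P i v = true) ->
  recursive n (fun v => least (fun i => P i v)).
Proof.
  (* [CMu] looks for a zero, so it is applied to the negated test. *)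
  intros HP Hex. apply decidable_negb in HP as [c Hc].
  exists (CMu c). intros v Hv. specialize (Hex v Hv). constructor.
  - specialize (Hc (least (fun i => P i v) :: v) ltac:(simpl; lia)). cbn in Hc.
    now rewrite least_spec with (P := fun i => P i v) in Hc.
  - intros m Hm. exists 0.
    specialize (Hc (m :: v) ltac:(simpl; lia)). cbn in Hc.
    now rewrite least_minimal with (P := fun i => P i v) in Hc.
Qed.

(** A finite list is hard-wired into the code by one conditional per entry. This is how an arbitrary
    finite chain becomes a computable enumeration. *)
Lemma recursive_table l n A : recursive n A -> recursive n (fun v => nth (A v) l 0).
Proof.
  intros HA. revert A HA. induction l as [|a l IH]; intros A HA.
  - apply recursive_ext with (fun _ => 0); [|recursive]. intros v _. now destruct (A v).
  - apply recursive_ext with (fun v => if A v =? 0 then a else nth (pred (A v)) l 0).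
    + intros v _. now destruct (A v).
    + recursive.
Qed.

(** An evaluator for each fixed code suffices, so induction on [c] replaces a universal function and
    no numbering of codes is required. *)
Lemma recursive_run c n : recursive (S n) (fun w => run c (nth 0 w 0) (tl w)).
Proof.
  revert n. induction c as [| |i|f gs IHf IHgs|f g IHf IHg|f IHf] using code_nested_ind;
    intros n; cbn [run].
  - recursive.
  - destruct n as [|n].
    + apply recursive_ext with (fun _ => 0); [|recursive].
      intros [|x [|y v]]; try discriminate. reflexivity.
    + apply recursive_ext with (fun w => S (S (nth 1 w 0))); [|recursive].
      intros [|x [|y v]]; try discriminate. reflexivity.
  - recursive.
  - apply recursive_if.
    + induction IHgs as [|g gs Hg _ IH]; simpl; [recursive|].
      apply (decidable_andb (S n) (fun w => negb (run g (nth 0 w 0) (tl w) =? 0))); [|exact IH].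
      recursive.
    + pose (Gs := (fun w : list nat => nth 0 w 0)
                  :: map (fun g w => pred (run g (nth 0 w 0) (tl w))) gs).
      apply recursive_ext with
        (fun w => (fun u => run f (nth 0 u 0) (tl u)) (map (fun G => G w) Gs)).
      { intros w _. cbn. now rewrite map_map. }
      apply (recursive_comp (S n) (fun u => run f (nth 0 u 0) (tl u)) Gs (IHf _)).
      constructor; [recursive|]. apply Forall_map. revert IHgs. apply Forall_impl.
      intros g Hg. recursive.
    + recursive.
  - destruct n as [|n].
    + apply recursive_ext with (fun _ => 0); [|recursive].
      intros [|x [|y v]]; try discriminate. reflexivity.
    + apply recursive_ext with
        (fun w => nat_rect (fun _ => nat) (run f (nth 0 w 0) (tl (tl w)))
           (fun i r => if r =? 0 then 0 else
                       run g (nth 0 w 0) (i :: pred r :: tl (tl w))) (nth 1 w 0)).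
      { intros [|x [|y v]]; try discriminate. reflexivity. }
      apply recursive_prec; [|recursive|].
      * apply (recursive_subst n 2 _ [fun w => nth 0 w 0] (fun w => tl (tl w)) (tl_tl n) (IHf n)).
        recursive.
      * apply recursive_ifzero; [recursive|recursive|].
        (* Inside the recursion the context is: counter, accumulator, budget, recursion bound,
           parameters. The code [g] gets the budget, the counter, the decoded accumulator and the
           parameters. *)
        apply (recursive_subst n 4 _
                 [fun w => nth 0 (tl (tl w)) 0; fun w => nth 0 w 0; fun w => pred (nth 1 w 0)]
                 (fun w => tl (tl (tl (tl w))))) with (2 := IHg (2 + n)).
        -- now intros [|a [|b [|x [|y w]]]].
        -- repeat constructor; recursive.
  - apply recursive_pred.
    assert (Hf : recursive (3 + n)
              (fun w => run f (nth 2 w 0) (nth 0 w 0 :: tl (tl (tl w))))).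
    { apply (recursive_subst n 3 _ [fun w => nth 2 w 0; fun w => nth 0 w 0]
               (fun w => tl (tl (tl w)))) with (2 := IHf (S n)).
      - now intros [|a [|b [|x w]]].
      - repeat constructor; recursive. }
    apply recursive_prec; [recursive|recursive|].
    apply recursive_ext with
      (fun w => if nth 1 w 0 =? 0
                then (if run f (nth 2 w 0) (nth 0 w 0 :: tl (tl (tl w))) =? 0 then 1
                      else if run f (nth 2 w 0) (nth 0 w 0 :: tl (tl (tl w))) =? 1
                           then S (S (nth 0 w 0)) else 0)
                else nth 1 w 0); [|recursive].
    intros [|a [|b [|x w]]]; try discriminate. reflexivity.
Qed.

Lemma decidable_app2 (P : nat -> nat -> bool) :
  decidable_rec 2 (fun v => P (nth 0 v 0) (nth 1 v 0)) ->
  forall n A B, recursive n A -> recursive n B -> decidable_rec n (fun v => P (A v) (B v)).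
Proof. apply (recursive_app2 (fun x y => Nat.b2n (P x y))). Qed.

(** * Pairs and arrays coded by numbers *)

Definition unpair_l (s : nat) : nat := fst (Cantor.of_nat s).
Definition unpair_r (s : nat) : nat := snd (Cantor.of_nat s).

(** The Cantor polynomial multiplied by 2 to avoid division. It makes both projections recursive by
    search, using only addition and multiplication. *)
Lemma unpair_characterization s x y :
  s * 2 = y * 2 + (y + x) * S (y + x) <-> unpair_l s = x /\ unpair_r s = y.
Proof.
  unfold unpair_l, unpair_r.
  rewrite <- (Cantor.cancel_to_of s) at 1. destruct (Cantor.of_nat s) as [a b] eqn:E.
  rewrite <- Cantor.to_nat_spec. cbn [fst snd]. split.
  - intros H. assert (H' : Cantor.to_nat (a, b) = Cantor.to_nat (x, y)) by lia.
    apply Cantor.to_nat_inj in H'. injection H' as -> ->. auto.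
  - intros [-> ->]. reflexivity.
Qed.

Lemma unpair_le s : unpair_l s <= s /\ unpair_r s <= s.
Proof.
  pose proof (proj2 (unpair_characterization s _ _) (conj eq_refl eq_refl)) as H. nia.
Qed.

Lemma recursive_unpair_l n A : recursive n A -> recursive n (fun v => unpair_l (A v)).
Proof.
  apply (recursive_app1 unpair_l).
  set (P := fun x s => existsb (fun y => s * 2 =? y * 2 + (y + x) * S (y + x)) (seq 0 (S s))).
  assert (HP : forall s x, P x s = true <-> unpair_l s = x).
  { intros s x. unfold P. rewrite existsb_exists. split.
    - intros (y & _ & E). now apply Nat.eqb_eq, unpair_characterization in E.
    - intros <-. exists (unpair_r s). split.
      + apply in_seq. pose proof (unpair_le s). lia.
      + now apply Nat.eqb_eq, unpair_characterization. }
  apply recursive_ext with (fun v => least (fun x => P x (nth 0 v 0))).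
  - intros v _. symmetry. apply HP. apply (least_spec (fun x => P x (nth 0 v 0))).
    exists (unpair_l (nth 0 v 0)). now apply HP.
  - apply recursive_least.
    + unfold P. recursive.
    + intros v _. exists (unpair_l (nth 0 v 0)). now apply HP.
Qed.

Lemma recursive_unpair_r n A : recursive n A -> recursive n (fun v => unpair_r (A v)).
Proof.
  apply (recursive_app1 unpair_r).
  set (P := fun y s => s * 2 =? y * 2 + (y + unpair_l s) * S (y + unpair_l s)).
  assert (HP : forall s y, P y s = true <-> unpair_r s = y).
  { intros s y. unfold P. rewrite Nat.eqb_eq, unpair_characterization. tauto. }
  pose proof recursive_unpair_l.
  apply recursive_ext with (fun v => least (fun y => P y (nth 0 v 0))).
  - intros v _. symmetry. apply HP. apply (least_spec (fun y => P y (nth 0 v 0))).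
    exists (unpair_r (nth 0 v 0)). now apply HP.
  - apply recursive_least.
    + unfold P. recursive.
    + intros v _. exists (unpair_r (nth 0 v 0)). now apply HP.
Qed.
#[local] Hint Resolve recursive_unpair_l recursive_unpair_r : rec.

(** Every number codes an infinite stream: pass to the right component i times, then take the left
    one. No length is stored. *)
Definition get (s i : nat) : nat := unpair_l (nat_rect (fun _ => nat) s (fun _ r => unpair_r r) i).

Lemma recursive_get n A B :
  recursive n A -> recursive n B -> recursive n (fun v => get (A v) (B v)).
Proof.
  intros HA HB. unfold get. apply recursive_unpair_l.
  apply (recursive_prec n A (fun _ r _ => unpair_r r) B); recursive.
Qed.
#[local] Hint Resolve recursive_get : rec.

Lemma array_exists (l : list nat) : exists s, forall i, i < length l -> get s i = nth i l 0.
Proof.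
  induction l as [|a l [s Hs]]; [exists 0; simpl; lia|].
  exists (Cantor.to_nat (a, s)).
  assert (Hr : forall i, nat_rect (fun _ => nat) (Cantor.to_nat (a, s)) (fun _ r => unpair_r r) (S i)
               = nat_rect (fun _ => nat) s (fun _ r => unpair_r r) i).
  { induction i as [|i IH]; [|cbn [nat_rect] in *; now rewrite IH].
    cbn [nat_rect]. unfold unpair_r. now rewrite Cantor.cancel_of_to. }
  intros [|i] Hi; unfold get.
  - cbn [nat_rect]. unfold unpair_l. now rewrite Cantor.cancel_of_to.
  - rewrite Hr. apply Hs. simpl in Hi. lia.
Qed.

(** The code of the array is searched for instead of being built, so only reading by [get] has to be
    recursive. Entries from [n] on are arbitrary. *)
Definition tabulate (n : nat) (F : nat -> nat) : nat :=
  least (fun s => forallb (fun i => get s i =? F i) (seq 0 n)).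

Lemma tabulate_witness n F : exists s, forallb (fun i => get s i =? F i) (seq 0 n) = true.
Proof.
  destruct (array_exists (map F (seq 0 n))) as [s Hs]. exists s.
  apply forallb_forall. intros i Hi. apply in_seq in Hi. apply Nat.eqb_eq.
  rewrite Hs by (rewrite length_map, length_seq; lia).
  rewrite nth_indep with (d' := F 0) by (rewrite length_map, length_seq; lia).
  now rewrite map_nth, seq_nth by lia.
Qed.

Lemma get_tabulate n F i : i < n -> get (tabulate n F) i = F i.
Proof.
  intros Hi. apply Nat.eqb_eq.
  pose proof (least_spec _ (tabulate_witness n F)) as H.
  rewrite forallb_forall in H. apply H. apply in_seq. lia.
Qed.

Lemma recursive_tabulate n m F :
  recursive (S n) (fun w => F (nth 0 w 0) (tl w)) ->
  recursive n (fun v => tabulate m (fun i => F i v)).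
Proof.
  intros HF. unfold tabulate. apply recursive_least.
  - apply (decidable_forallb (S n) (fun i w => get (nth 0 w 0) i =? F i (tl w))); [recursive|].
    apply decidable_eqb; [recursive|].
    apply (recursive_subst n 2 _ [fun w => nth 0 w 0] (fun w => tl (tl w)) (tl_tl n) HF).
    recursive.
  - intros v _. apply tabulate_witness.
Qed.

(** * Partial computable functions, maxima and complexity *)

Lemma enc_bits_bounds p : length p <= enc_bits p < 2 ^ S (length p).
Proof.
  unfold enc_bits.
  (* Adding 2 makes the accumulator bound exactly multiplicative: appending a bit yields at most
     [2 * (n + 2)]. *)
  assert (H : forall n, n + length p <= fold_left (fun n (b : bool) => 2 * n + (if b then 2 else 1)) p n
              /\ fold_left (fun n (b : bool) => 2 * n + (if b then 2 else 1)) p n + 2 <= (n + 2) * 2 ^ length p).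
  { induction p as [|b p IH]; intros n; [simpl; lia|]. cbn [fold_left length].
    specialize (IH (2 * n + (if b then 2 else 1))). rewrite Nat.pow_succ_r'.
    destruct b; nia. }
  specialize (H 0). rewrite Nat.pow_succ_r'. lia.
Qed.

Lemma enc_bits_surjective n : exists p, enc_bits p = n.
Proof.
  induction n as [n IH] using lt_wf_ind. destruct n as [|n]; [now exists []|].
  destruct (IH (Nat.div2 n)) as [p Hp]; [pose proof (Nat.div2_decr n n); lia|].
  exists (p ++ [Nat.odd n]). unfold enc_bits in *. rewrite fold_left_app, Hp. simpl.
  pose proof (Nat.div2_odd n). destruct (Nat.odd n); simpl in *; lia.
Qed.

Section Values.

Context {D : Type} (rho : nat -> D).

Definition decode (y : nat) : option D :=
  match y with 0 => None | S n => Some (rho n) end.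

Lemma partial_computable2_decode (F : nat -> nat -> nat) :
  bijective_enum rho ->
  recursive 2 (fun v => F (nth 0 v 0) (nth 1 v 0)) ->
  partial_computable2 rho (fun p t => decode (F (enc_bits p) t)).
Proof.
  intros [Hinj _] HF.
  destruct HF as [c Hc].
  destruct (recursive_pred 2 (fun v => nth 0 v 0) ltac:(recursive)) as [cp Hp].
  (* The search for a zero of [1 - F] ignores its search variable: it returns 0 at once where [F] is
     positive and diverges where [F] is 0. Run beside [F], it produces exactly the required
     domain. *)
  assert (Hs : recursive 3 (fun v => 1 - F (nth 1 v 0) (nth 2 v 0))).
  { apply recursive_sub; [recursive|].
    apply (recursive_app2 F); [now exists c|recursive|recursive]. }
  destruct Hs as [cs Hs].
  exists (CComp cp [c; CMu cs]). intros p t y.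
  specialize (Hc [enc_bits p; t] eq_refl). cbn in Hc.
  assert (Hs' := fun m => Hs [m; enc_bits p; t] eq_refl). cbn in Hs'.
  destruct (F (enc_bits p) t) as [|z]; cbn in *; split.
  - intros H. inversion H as [| | |f' gs' v' ys y' Hgs Hf| | |]; subst.
    inversion Hgs as [|? ? ? ? ? _ Hgs']; subst. inversion Hgs' as [|? ? ? ? ? Hmu _]; subst.
    inversion Hmu; subst.
    match goal with Hn : eval cs _ 0 |- _ =>
      discriminate (eval_functional _ _ _ _ Hn (Hs' _)) end.
  - discriminate.
  - assert (Hz : eval (CComp cp [c; CMu cs]) [enc_bits p; t] z).
    { apply ev_comp with [S z; 0]; [|exact (Hp [S z; 0] eq_refl)].
      repeat constructor; [assumption|apply Hs'|lia]. }
    intros H. now rewrite (eval_functional _ _ _ _ H Hz).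
  - intros [= Hy]. apply Hinj in Hy as <-.
    apply ev_comp with [S z; 0].
    + repeat constructor; [assumption|apply Hs'|lia].
    + exact (Hp [S z; 0] eq_refl).
Qed.

(** The additional argument is the budget of [run]: the graph of a partial function becomes a union
    of decidable stages, ready for dovetailing. *)
Lemma partial_computable2_stages f :
  partial_computable2 rho f ->
  exists F : nat -> nat -> nat -> nat,
    recursive 3 (fun v => F (nth 0 v 0) (nth 1 v 0) (nth 2 v 0)) /\
    forall p u y, f p u = Some (rho y) <-> exists w, F w (enc_bits p) u = S y.
Proof.
  intros [c Hc]. exists (fun w q u => run c w [q; u]). split.
  - apply recursive_ext with (fun v => run c (nth 0 v 0) (tl v)); [|apply recursive_run].
    intros [|w [|q [|u [|]]]]; try discriminate. reflexivity.
  - intros p u y. rewrite <- Hc. split.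
    + intros H. apply run_complete in H as [w Hw]. exists w. now apply Hw.
    + intros [w Hw]. eapply run_sound; eassumption.
Qed.

Lemma computable_spo_decidable lt :
  computable_spo rho lt ->
  exists ltb : nat -> nat -> bool,
    decidable_rec 2 (fun v => ltb (nth 0 v 0) (nth 1 v 0)) /\
    forall m n, ltb m n = true <-> lt (rho m) (rho n).
Proof.
  intros (_ & _ & _ & c & Hc).
  exists (fun m n => if excluded_middle_informative (lt (rho m) (rho n)) then true else false).
  split.
  - exists c. intros [|m [|n [|]]]; try discriminate. intros _. apply Hc. cbn.
    destruct (excluded_middle_informative _); auto.
  - intros m n. destruct (excluded_middle_informative _); split; easy.
Qed.

Lemma computable_spo_rev lt : computable_spo rho lt -> computable_spo rho (rev_order lt).
Proof.
  intros (Hbij & Hirr & Htrans & c & Hc). unfold rev_order.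
  split; [exact Hbij|]. split; [exact Hirr|]. split; [eauto|].
  exists (CComp c [CProj 1; CProj 0]). intros m n y. rewrite <- Hc. split.
  - intros H. inversion H as [| | |f' gs' v' ys y' Hgs Hf| | |]; subst.
    assert (E : evals [CProj 1; CProj 0] [m; n] [n; m]) by (repeat constructor).
    inversion Hgs as [|? ? ? ? ? H1 H2]; subst. inversion H1; subst.
    inversion H2 as [|? ? ? ? ? H3 H4]; subst. inversion H3; subst.
    inversion H4; subst. exact Hf.
  - intros H. apply ev_comp with [n; m]; [repeat constructor|exact H].
Qed.

Lemma is_max_value_unique lt f p d e :
  computable_spo rho lt -> is_max_value lt f p d -> is_max_value lt f p e -> d = e.
Proof.
  intros (_ & Hirr & Htrans & _) (_ & [t Ht] & Hd) (_ & [u Hu] & He).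
  destruct (Hd _ _ Hu) as [->|H1]; [reflexivity|].
  destruct (He _ _ Ht) as [->|H2]; [reflexivity|].
  destruct (Hirr _ (Htrans _ _ _ H1 H2)).
Qed.

Lemma MaxPR_intro lt f :
  computable_spo rho lt -> partial_computable2 rho f -> monotone2 lt f ->
  exists phi, MaxPR rho lt phi /\ forall p d, phi p = Some d <-> is_max_value lt f p d.
Proof.
  intros Hlt Hf Hmono.
  exists (fun p => match excluded_middle_informative (exists d, is_max_value lt f p d) with
                   | left H => Some (proj1_sig (constructive_indefinite_description _ H))
                   | right _ => None
                   end).
  match goal with |- MaxPR rho lt ?phi /\ ?E => assert (H : E) end.
  { intros p d. destruct (excluded_middle_informative _) as [H|H].
    - destruct (constructive_indefinite_description _ H) as [e He]. cbn. split.
      + now intros [= <-].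
      + intros Hd. f_equal. eauto using is_max_value_unique.
    - split; [discriminate|]. intros Hd. destruct H. eauto. }
  split; [|exact H]. exists f. auto.
Qed.

Lemma K_correct (phi : list bool -> option D) d : Kdef phi d -> K_spec phi d (K phi d).
Proof.
  intros Hd. unfold K. apply epsilon_spec.
  destruct (least_witness (fun n => if excluded_middle_informative
                            (exists p, phi p = Some d /\ length p = n) then true else false))
    as (n & Hn & Hmin).
  { destruct Hd as [p Hp]. exists (length p).
    destruct (excluded_middle_informative _) as [|H]; [reflexivity|]. destruct H. eauto. }
  exists n. destruct (excluded_middle_informative _) as [H|]; [|discriminate].
  split; [exact H|]. intros p Hp. apply Nat.nlt_ge. intros Hlt.
  specialize (Hmin _ Hlt). destruct (excluded_middle_informative _) as [|H']; [discriminate|].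
  apply H'. eauto.
Qed.

(** Optimality in the form used below: to bound [K U] it is enough to exhibit a monotone enumeration
    with the right maximum. *)
Lemma optimal_max_bound lt U f :
  computable_spo rho lt -> optimal_max rho lt U ->
  partial_computable2 rho f -> monotone2 lt f ->
  exists c, forall p d, is_max_value lt f p d -> Kdef U d /\ K U d <= length p + c.
Proof.
  intros Hlt [_ Hopt] Hf Hmono.
  destruct (MaxPR_intro lt f) as (phi & Hphi & Heq); try assumption.
  destruct (Hopt phi Hphi) as [c Hc]. exists c. intros p d Hd. apply Heq in Hd.
  assert (Hdef : Kdef phi d) by (now exists p).
  destruct (Hc d Hdef). split; [assumption|].
  pose proof (proj2 (K_correct phi d Hdef) p Hd). lia.
Qed.

(** The machine that constantly shows [rho (enc_bits p)] reaches every element, because [enc_bits]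
    is onto. Hence [K U] is never a junk value of [epsilon]. *)
Lemma optimal_max_total lt U d : computable_spo rho lt -> optimal_max rho lt U -> Kdef U d.
Proof.
  intros Hlt HU. destruct (proj2 (proj1 Hlt) d) as [n <-].
  destruct (optimal_max_bound lt U (fun p _ => decode (S (enc_bits p)))) as [c Hc];
    try assumption.
  - apply (partial_computable2_decode (fun q _ => S q)); [apply Hlt|recursive].
  - intros p t1 t2 d1 d2 _ [= <-] [= <-]. now left.
  - destruct (enc_bits_surjective n) as [p Hp]. apply (Hc p). split; [|split].
    + exists [rho n]. intros e [_ [= <-]]. rewrite Hp. now left.
    + exists 0. simpl. now rewrite Hp.
    + intros _ e [= <-]. rewrite Hp. now left.
Qed.

Lemma optimal_max_shortest lt U :
  optimal_max rho lt U ->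
  exists f, partial_computable2 rho f /\ monotone2 lt f /\
    forall d, Kdef U d -> exists p, is_max_value lt f p d /\ length p = K U d.
Proof.
  intros [(f & Hf & Hmono & Hmax) _]. exists f. split; [assumption|]. split; [assumption|].
  intros d Hd. destruct (K_correct U d Hd) as [(p & Hp & Hl) _]. exists p.
  split; [now apply Hmax|assumption].
Qed.

Lemma is_max_value_weaken (lt lt' : D -> D -> Prop) f p d :
  (forall x y, lt x y -> lt' x y) -> is_max_value lt f p d -> is_max_value lt' f p d.
Proof.
  intros Hext (Hfin & Hd & Hle). split; [assumption|]. split; [assumption|].
  intros t e He. destruct (Hle t e He); auto.
Qed.

(** A wk-monotone enumeration is st-monotone with the same maximum, so a machine for wk is a machine
    for st. *)
Lemma le_ct_extension (st wk : D -> D -> Prop) Ust Uwk :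
  computable_spo rho st -> computable_spo rho wk -> (forall x y, wk x y -> st x y) ->
  optimal_max rho st Ust -> optimal_max rho wk Uwk -> le_ct (K Ust) (K Uwk).
Proof.
  intros Hst Hwk Hext HUst HUwk.
  destruct (optimal_max_shortest wk Uwk HUwk) as (f & Hf & Hmono & Hshort).
  destruct (optimal_max_bound st Ust f) as [c Hc]; try assumption.
  { intros p t1 t2 d1 d2 Ht H1 H2. destruct (Hmono p t1 t2 d1 d2 Ht H1 H2); auto. }
  exists c. intros d.
  destruct (Hshort d) as (p & Hp & <-); [eauto using optimal_max_total|].
  apply Hc. eauto using is_max_value_weaken.
Qed.

Lemma finite_chain_least {T : Type} (lt : T -> T -> Prop) (l : list T) :
  (forall x y z, lt x y -> lt y z -> lt x z) ->
  (forall x y, In x l -> In y l -> x = y \/ lt x y \/ lt y x) ->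
  l <> [] -> exists m, In m l /\ forall x, In x l -> x = m \/ lt m x.
Proof.
  intros Htrans. induction l as [|a l IH]; intros Hchain Hne; [easy|].
  destruct l as [|b l].
  - exists a. split; [now left|]. intros x [<-|[]]. now left.
  - destruct IH as (m & Hm & Hle); [|discriminate|].
    { intros x y Hx Hy. apply Hchain; now right. }
    destruct (Hchain a m) as [->|[Ham|Hma]]; [now left|now right| | |].
    + exists m. split; [now left|]. intros x [<-|Hx]; auto.
    + exists a. split; [now left|]. intros x [<-|Hx]; [now left|].
      right. destruct (Hle x Hx) as [->|]; eauto.
    + exists m. split; [now right|]. intros x [<-|Hx]; auto.
Qed.

Lemma monotone2_comparable (lt : D -> D -> Prop) f p t u d e :
  monotone2 lt f -> f p t = Some d -> f p u = Some e -> d = e \/ lt d e \/ lt e d.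
Proof.
  intros Hmono Hd He. destruct (Nat.le_ge_cases t u) as [H|H].
  - destruct (Hmono p t u d e H Hd He); auto.
  - destruct (Hmono p u t e d H He Hd); auto.
Qed.

Lemma finite_range_has_max (lt : D -> D -> Prop) f p (l : list D) :
  (forall x y z, lt x y -> lt y z -> lt x z) -> monotone2 lt f ->
  (forall e, (exists t, f p t = Some e) -> In e l) -> (exists t e, f p t = Some e) ->
  exists d, is_max_value lt f p d.
Proof.
  intros Htrans Hmono Hl (t0 & e0 & H0).
  set (inrange := fun e => if excluded_middle_informative (exists t, f p t = Some e)
                           then true else false).
  assert (Hin : forall e, In e (filter inrange l) <-> exists t, f p t = Some e).
  { intros e. rewrite filter_In. unfold inrange.
    destruct (excluded_middle_informative _); split; try easy; auto. }
  destruct (finite_chain_least (fun x y => lt y x) (filter inrange l)) as (d & Hd & Hmax).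
  - eauto.
  - intros x y Hx Hy. apply Hin in Hx as [t Ht], Hy as [u Hu].
    destruct (monotone2_comparable lt f p t u x y Hmono Ht Hu) as [|[|]]; auto.
  - intros Hnil. assert (H : In e0 (filter inrange l)) by (apply Hin; eauto).
    rewrite Hnil in H. destruct H.
  - exists d. split; [now exists l|]. split; [now apply Hin|].
    intros t e He. apply Hmax, Hin. eauto.
Qed.

(** * Complexity gap *)

(** Pigeonhole: if all of [l] were reached, choosing for each function the one element of [l] that
    it meets would map [gs] onto [l]. *)
Lemma antichain_unreached (l : list D) (gs : list (nat -> option D)) :
  NoDup l -> length gs < length l ->
  (forall g x y t u, In g gs -> In x l -> In y l -> g t = Some x -> g u = Some y -> x = y) ->
  exists x, In x l /\ forall g t, In g gs -> g t <> Some x.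
Proof.
  intros Hnd Hlen Hone. destruct (classic (exists x, In x l /\ forall g t, In g gs -> g t <> Some x))
    as [|Hno]; [assumption|exfalso].
  destruct l as [|d0 l']; [simpl in Hlen; lia|]. set (l := d0 :: l') in *.
  set (hit := fun g : nat -> option D => epsilon (inhabits d0) (fun x => In x l /\ exists t, g t = Some x)).
  enough (H : incl l (map hit gs)).
  { apply (NoDup_incl_length Hnd) in H. rewrite length_map in H. lia. }
  intros x Hx. apply NNPP. intros Hnot. apply Hno. exists x. split; [assumption|].
  intros g t Hg Ht. apply Hnot, in_map_iff. exists g. split; [|assumption].
  destruct (epsilon_spec (inhabits d0) (fun x => In x l /\ exists t, g t = Some x))
    as (Hy & u & Hu); [eauto|]. fold (hit g) in Hy, Hu. eauto.
Qed.

Lemma forallb_seq (P : nat -> bool) n :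
  forallb P (seq 0 n) = true <-> forall i, i < n -> P i = true.
Proof.
  rewrite forallb_forall. split; intros H i Hi; apply H; [apply in_seq; lia|].
  apply in_seq in Hi. lia.
Qed.

Lemma existsb_seq (P : nat -> bool) n :
  existsb P (seq 0 n) = true <-> exists i, i < n /\ P i = true.
Proof.
  rewrite existsb_exists. split; intros (i & Hi & HP); exists i; split; try assumption.
  - apply in_seq in Hi. lia.
  - apply in_seq. lia.
Qed.

Lemma enc_bits_section : exists dec, forall n, enc_bits (dec n) = n.
Proof.
  exists (fun n => proj1_sig (constructive_indefinite_description _ (enc_bits_surjective n))).
  intros n. now destruct (constructive_indefinite_description _ _).
Qed.

Lemma map_surjective : bijective_enum rho -> forall l : list D, exists ln, map rho ln = l.
Proof.
  intros [_ Hsurj]. induction l as [|d l [ln <-]]; [now exists []|].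
  destruct (Hsurj d) as [n <-]. now exists (n :: ln).
Qed.

(* The program p searches for an array of more than 2 * bound (enc_bits p) entries that is
   an st-chain and a wk-antichain, and follows its st-least entry not yet produced by f1 or
   f2 on a program below the bound. *)
Lemma chain_element_avoiding (st wk : D -> D -> Prop) f1 f2 (bound : nat -> nat) :
  computable_spo rho st -> computable_spo rho wk -> cond_star st wk ->
  partial_computable2 rho f1 -> monotone2 wk f1 ->
  partial_computable2 rho f2 -> monotone2 (rev_order wk) f2 ->
  recursive 1 (fun v => bound (nth 0 v 0)) ->
  exists f, partial_computable2 rho f /\ monotone2 st f /\
    forall p, exists d, is_max_value st f p d /\
      forall p', enc_bits p' < bound (enc_bits p) -> forall u, f1 p' u <> Some d /\ f2 p' u <> Some d.
Proof.
  intros Hst Hwk Hstar Hf1 Hm1 Hf2 Hm2 Hbound.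
  destruct (computable_spo_decidable st Hst) as (stb & Rstb & Hstb).
  destruct (computable_spo_decidable wk Hwk) as (wkb & Rwkb & Hwkb).
  destruct (partial_computable2_stages f1 Hf1) as (F1 & RF1 & HF1).
  destruct (partial_computable2_stages f2 Hf2) as (F2 & RF2 & HF2).
  destruct Hst as (Hbij & Hirr & Htrans & _). destruct Hbij as [Hinj Hsurj].
  pose proof (recursive_app1 bound Hbound) as Rbound.
  pose proof (decidable_app2 stb Rstb) as Rstb'. pose proof (decidable_app2 wkb Rwkb) as Rwkb'.
  pose proof (recursive_app3 F1 RF1) as RF1'. pose proof (recursive_app3 F2 RF2) as RF2'.
  clear Rstb Rwkb RF1 RF2 Hbound.
  set (N := fun n => S (2 * bound n)).
  set (good := fun s n =>
    forallb (fun i => forallb (fun j =>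
      (i =? j) || ((stb (get s i) (get s j) || stb (get s j) (get s i))
                   && negb (wkb (get s i) (get s j))))%bool (seq 0 (N n))) (seq 0 (N n))).
  set (chain := fun n => least (fun s => good s n)).
  (* The time t bounds both the argument u and the budget w, so [hit] is decidable and, once true,
     stays true. *)
  set (hit := fun x t n =>
    existsb (fun q => existsb (fun u => existsb (fun w =>
      (F1 w q u =? S x) || (F2 w q u =? S x))%bool
        (seq 0 (S t))) (seq 0 (S t))) (seq 0 (bound n))).
  set (follow := fun x t n =>
    (existsb (fun i => get (chain n) i =? x) (seq 0 (N n)) && negb (hit x t n) &&
     forallb (fun j => hit (get (chain n) j) t n || (get (chain n) j =? x) ||
                       stb x (get (chain n) j)) (seq 0 (N n)))%bool).
  assert (Hgood : forall s n, good s n = true <-> forall i j, i < N n -> j < N n -> i <> j ->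
            (st (rho (get s i)) (rho (get s j)) \/ st (rho (get s j)) (rho (get s i))) /\
            ~ wk (rho (get s i)) (rho (get s j))).
  { intros s n. unfold good. rewrite forallb_seq. split.
    - intros H i j Hi Hj Hij. specialize (H i Hi). rewrite forallb_seq in H. specialize (H j Hj).
      apply Nat.eqb_neq in Hij. rewrite Hij in H. cbn in H.
      rewrite Bool.andb_true_iff, Bool.orb_true_iff, Bool.negb_true_iff in H.
      rewrite <- !Hstb, <- Hwkb. destruct H as [H ->]. auto.
    - intros H i Hi. apply forallb_seq. intros j Hj.
      destruct (Nat.eqb_spec i j) as [|Hij]; [reflexivity|]. cbn.
      specialize (H i j Hi Hj Hij). rewrite <- !Hstb, <- Hwkb in H.
      rewrite Bool.andb_true_iff, Bool.orb_true_iff, Bool.negb_true_iff.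
      destruct H as [H Hn]. split; [assumption|]. now apply Bool.not_true_is_false. }
  assert (Hgood_ex : forall n, exists s, good s n = true).
  { intros n. destruct (Hstar (N n)) as (l & Hlen & Hnd & Hchain & Hanti).
    destruct (map_surjective (conj Hinj Hsurj) l) as [ln <-]. rewrite length_map in Hlen.
    destruct (array_exists ln) as [s Hs]. rewrite Hlen in Hs. exists s. apply Hgood.
    intros i j Hi Hj Hij. rewrite (Hs i Hi), (Hs j Hj).
    assert (Hin : forall k, k < N n -> In (rho (nth k ln 0)) (map rho ln))
      by (intros k Hk; apply in_map, nth_In; lia).
    split; [|now apply Hanti; apply Hin]. apply Hchain; [now apply Hin|now apply Hin|].
    intros E. apply Hij. apply Hinj in E. apply NoDup_map_inv in Hnd.
    apply (proj1 (NoDup_nth ln 0) Hnd); [lia|lia|assumption]. }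
  assert (Hchain : forall n, good (chain n) n = true)
    by (intros n; exact (least_spec (fun s => good s n) (Hgood_ex n))).
  setoid_rewrite Hgood in Hchain.
  set (entries := fun n => map (fun i => rho (get (chain n) i)) (seq 0 (N n))).
  assert (Hentries : forall n d, In d (entries n) <->
                       exists i, i < N n /\ rho (get (chain n) i) = d).
  { intros n d. unfold entries. rewrite in_map_iff. split.
    - intros (i & Hd & Hi). apply in_seq in Hi. exists i. split; [lia|assumption].
    - intros (i & Hi & Hd). exists i. split; [assumption|]. apply in_seq. lia. }
  assert (Hhit : forall x t n, hit x t n = true <->
            exists q u w, q < bound n /\ u <= t /\ w <= t /\ (F1 w q u = S x \/ F2 w q u = S x)).
  { intros x t n. unfold hit. rewrite existsb_seq. setoid_rewrite existsb_seq.
    setoid_rewrite existsb_seq. setoid_rewrite Bool.orb_true_iff. setoid_rewrite Nat.eqb_eq.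
    split.
    - intros (q & Hq & u & Hu & w & Hw & H). exists q, u, w. repeat split; (lia || assumption).
    - intros (q & u & w & Hq & Hu & Hw & H). exists q. split; [assumption|].
      exists u. split; [lia|]. exists w. split; [lia|assumption]. }
  (* Some entry is never hit at any time. Hence a least unhit entry exists at every stage, and the
     search defining [value] always ends. *)
  assert (Hfree : forall n, exists i, i < N n /\ forall t, hit (get (chain n) i) t n = false).
  { intros n. destruct enc_bits_section as [dec Hdec].
    destruct (antichain_unreached (entries n)
                (map (fun q => f1 (dec q)) (seq 0 (bound n)) ++
                 map (fun q => f2 (dec q)) (seq 0 (bound n)))) as (d & Hd & Hnot).
    - apply (NoDup_nth _ (rho 0)). unfold entries. rewrite length_map, length_seq.
      intros i j Hi Hj E. destruct (Nat.eq_dec i j) as [|Hij]; [assumption|exfalso].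
      set (g := fun i => rho (get (chain n) i)) in *.
      rewrite nth_indep with (d' := g 0) in E by now rewrite length_map, length_seq.
      rewrite nth_indep with (d := rho 0) (d' := g 0) in E
        by now rewrite length_map, length_seq.
      rewrite !map_nth, !seq_nth in E by assumption. change (rho (get (chain n) i) = rho (get (chain n) j)) in E.
      destruct (Hchain n i j Hi Hj Hij) as [[H|H] _]; rewrite E in H; exact (Hirr _ H).
    - unfold entries. rewrite length_app, !length_map, !length_seq. unfold N. lia.
    - assert (Hanti : forall x y, In x (entries n) -> In y (entries n) ->
                        x = y \/ wk x y \/ wk y x -> x = y).
      { intros x y Hx Hy Hcomp. apply Hentries in Hx as (i & Hi & <-), Hy as (j & Hj & <-).
        destruct (Nat.eq_dec i j) as [->|Hij]; [reflexivity|].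
        destruct Hcomp as [|[H|H]]; [assumption| |]; exfalso.
        - now apply (Hchain n i j Hi Hj Hij).
        - now apply (Hchain n j i Hj Hi (not_eq_sym Hij)). }
      intros g x y t u Hg Hx Hy Ht Hu. apply Hanti; try assumption.
      apply in_app_or in Hg as [Hg|Hg]; apply in_map_iff in Hg as (q & <- & _).
      + exact (monotone2_comparable wk f1 (dec q) t u x y Hm1 Ht Hu).
      + destruct (monotone2_comparable _ f2 (dec q) t u x y Hm2 Ht Hu) as [|[|]]; auto.
    - apply Hentries in Hd as (i & Hi & <-). exists i. split; [assumption|]. intros t.
      apply Bool.not_true_is_false. intros Hh.
      apply Hhit in Hh as (q & u & w & Hq & _ & _ & H).
      rewrite <- (Hdec q) in H.
      destruct H as [H|H].
      + apply (Hnot (f1 (dec q)) u); [|apply HF1; eauto].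
        apply in_or_app; left. apply (in_map (fun q => f1 (dec q))), in_seq. lia.
      + apply (Hnot (f2 (dec q)) u); [|apply HF2; eauto].
        apply in_or_app; right. apply (in_map (fun q => f2 (dec q))), in_seq. lia. }
  assert (Hfollow : forall x t n, follow x t n = true <->
            (exists i, i < N n /\ get (chain n) i = x) /\ hit x t n = false /\
            forall j, j < N n -> hit (get (chain n) j) t n = true \/
                      get (chain n) j = x \/ st (rho x) (rho (get (chain n) j))).
  { intros x t n. unfold follow.
    rewrite !Bool.andb_true_iff, existsb_seq, forallb_seq, Bool.negb_true_iff.
    setoid_rewrite Bool.orb_true_iff. setoid_rewrite Bool.orb_true_iff.
    setoid_rewrite Nat.eqb_eq. setoid_rewrite Hstb.
    setoid_rewrite or_assoc. tauto. }
  assert (Hfollow_ex : forall t n, exists x, follow x t n = true).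
  { intros t n. destruct (Hfree n) as (i0 & Hi0 & Hh0).
    set (l := filter (fun x => negb (hit x t n)) (map (get (chain n)) (seq 0 (N n)))).
    assert (Hl : forall x, In x l <-> (exists i, i < N n /\ get (chain n) i = x) /\
                                      hit x t n = false).
    { intros x. unfold l. rewrite filter_In, in_map_iff, Bool.negb_true_iff.
      setoid_rewrite in_seq. split.
      - intros ((i & Hx & Hi) & H). split; [|assumption]. exists i. split; [lia|assumption].
      - intros ((i & Hi & Hx) & H). split; [|assumption]. exists i. split; [assumption|lia]. }
    destruct (finite_chain_least (fun x y => st (rho x) (rho y)) l) as (m & Hm & Hleast).
    - eauto.
    - intros x y Hx Hy. apply Hl in Hx as [(i & Hi & <-) _], Hy as [(j & Hj & <-) _].
      destruct (Nat.eq_dec i j) as [->|Hij]; [now left|right].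
      now apply (Hchain n i j).
    - intros E. assert (H : In (get (chain n) i0) l) by (apply Hl; eauto).
      rewrite E in H. destruct H.
    - apply Hl in Hm as [Hm1' Hm2']. exists m. apply Hfollow.
      split; [assumption|]. split; [assumption|].
      intros j Hj. destruct (hit (get (chain n) j) t n) eqn:E; [now left|right].
      apply Hleast, Hl. eauto. }
  set (value := fun n t => S (least (fun x => follow x t n))).
  assert (Hvalue := fun n t => proj1 (Hfollow _ t n) (least_spec _ (Hfollow_ex t n))).
  cbv beta in Hvalue.
  assert (Rvalue : recursive 2 (fun v => value (nth 0 v 0) (nth 1 v 0))).
  { assert (RN : forall n A, recursive n A -> recursive n (fun v => N (A v)))
      by (intros; unfold N; recursive).
    assert (Rchain : forall n A, recursive n A -> recursive n (fun v => chain (A v))).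
    { apply recursive_app1. unfold chain. apply recursive_least; [|auto].
      unfold good. recursive. }
    assert (Rhit : forall n A B C, recursive n A -> recursive n B -> recursive n C ->
                     decidable_rec n (fun v => hit (A v) (B v) (C v))).
    { apply (recursive_app3 (fun x t n => Nat.b2n (hit x t n))). unfold hit. recursive. }
    unfold value. apply recursive_S, recursive_least; [|auto].
    unfold follow. recursive. }
  exists (fun p t => decode (value (enc_bits p) t)).
  (* The entry followed at the later time is unhit then, hence unhit earlier, so the earlier choice
     was st-below or equal to it. *)
  assert (Hmono : monotone2 st (fun p t => decode (value (enc_bits p) t))).
  { intros p t1 t2 d1 d2 Ht [= <-] [= <-]. set (n := enc_bits p).
    destruct (Hvalue n t1) as (_ & _ & Hleast).
    destruct (Hvalue n t2) as ((j & Hj & <-) & Hh & _).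
    destruct (Hleast j Hj) as [H|[H|H]]; [|now left; f_equal|now right].
    apply Hhit in H as (q & u & w & H).
    enough (hit (get (chain n) j) t2 n = true) by congruence.
    apply Hhit. exists q, u, w. intuition lia. }
  split; [now apply partial_computable2_decode|]. split; [exact Hmono|].
  intros p. set (n := enc_bits p).
  destruct (finite_range_has_max st (fun p t => decode (value (enc_bits p) t)) p (entries n))
    as (d & Hd); try assumption.
  { intros e (t & [= <-]). apply Hentries. destruct (Hvalue n t) as ((i & Hi & E) & _).
    exists i. split; [assumption|]. fold n. now rewrite E. }
  { exists 0. eexists. reflexivity. }
  exists d. split; [assumption|].
  destruct Hd as (_ & [t0 Ht0] & Hmax). injection Ht0 as Ht0.
  (* After the maximum is attained, monotonicity bounds the value from below and maximality from
     above. *)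
  assert (Hstable : forall t, t0 <= t -> value n t = value n t0).
  { intros t Ht. unfold value. f_equal. apply Hinj.
    set (x := fun t => least (fun x => follow x t n)) in *. change (rho (x t0) = d) in Ht0.
    change (rho (x t) = rho (x t0)).
    destruct (Hmax t (rho (x t)) eq_refl) as [E|H]; [congruence|].
    destruct (Hmono p t0 t (rho (x t0)) (rho (x t)) Ht eq_refl eq_refl) as [E|H'];
      [now symmetry|].
    rewrite <- Ht0 in H. destruct (Hirr _ (Htrans _ _ _ H H')). }
  assert (Hnever : forall q u w, q < bound n -> forall x, rho x = d ->
                     ~ (F1 w q u = S x \/ F2 w q u = S x)).
  { intros q u w Hq x Hx H.
    (* A time late enough both for the value to be stable and for the stage (u, w) to have been
       inspected. *)
    destruct (Hvalue n (t0 + u + w)) as (_ & Hh & _).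
    assert (E := Hstable (t0 + u + w) ltac:(lia)). unfold value in E. injection E as E.
    rewrite E in Hh. rewrite <- Ht0 in Hx. apply Hinj in Hx. fold n in Hx.
    rewrite <- Hx in Hh.
    enough (hit x (t0 + u + w) n = true) by congruence.
    apply Hhit. exists q, u, w. intuition lia. }
  intros p' Hp' u. destruct (Hsurj d) as [x <-].
  rewrite HF1, HF2. split; intros [w Hw].
  - exact (Hnever _ u w Hp' x eq_refl (or_introl Hw)).
  - exact (Hnever _ u w Hp' x eq_refl (or_intror Hw)).
Qed.

Lemma le_sum_map {T : Type} (g : T -> nat) l x : In x l -> g x <= list_sum (map g l).
Proof.
  induction l as [|a l IH]; [easy|]. intros [<-|Hx]; simpl; [lia|]. specialize (IH Hx). lia.
Qed.

(** Given a finite list supposed to contain all elements with the gap, a program is chosen whose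
    associated element has the gap and a wk-complexity too large for membership in the list. *)
Lemma infinite_complexity_gap (st wk : D -> D -> Prop) Ust U1 U2 (alpha : nat -> nat) :
  computable_spo rho st -> computable_spo rho wk -> cond_star st wk ->
  optimal_max rho st Ust -> optimal_max rho wk U1 -> optimal_max rho (rev_order wk) U2 ->
  total_computable alpha ->
  infinite_set (fun d => Nat.min (K U2 d) (K U1 d) >= alpha (K Ust d)).
Proof.
  intros Hst Hwk Hstar HUst HU1 HU2 Halpha [l Hl].
  pose proof (computable_spo_rev wk Hwk) as Hrev.
  destruct (optimal_max_shortest wk U1 HU1) as (f1 & Hf1 & Hm1 & Hshort1).
  destruct (optimal_max_shortest _ U2 HU2) as (f2 & Hf2 & Hm2 & Hshort2).
  (* The sum dominates [alpha i] for all i up to 2 n, without monotonicity of [alpha]; the summand n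
     forces the complexity to grow. *)
  set (gap := fun n => n + list_sum (map alpha (seq 0 (S (2 * n))))).
  destruct (chain_element_avoiding st wk f1 f2 (fun n => 2 ^ gap n))
    as (f & Hf & Hmono & Hmax); try assumption.
  { assert (Ra : forall n A, recursive n A -> recursive n (fun v => alpha (A v))).
    { apply recursive_app1. destruct Halpha as [c Hc]. exists c.
      intros [|x [|]] Hv; try discriminate. now apply Hc. }
    unfold gap. apply recursive_pow; [recursive|]. apply recursive_add; [recursive|].
    apply (recursive_sum 1 (fun i _ => alpha i)); recursive. }
  destruct (optimal_max_bound st Ust f) as [c Hc]; try assumption.
  set (b := S (list_sum (map (K U1) l))).
  (* The string p has length at most [c + b], so [K Ust d] is at most [2 * (c + b)], within the
     range of the sum; [b] exceeds [K U1] on the whole list [l]. *)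
  destruct (enc_bits_surjective (c + b)) as [p Hp]. destruct (Hmax p) as (d & Hd & Havoid).
  rewrite Hp in Havoid. destruct (Hc p d Hd) as [_ HK].
  assert (Hlarge : forall U lt f' i, f' = f1 \/ f' = f2 -> optimal_max rho lt U ->
            computable_spo rho lt ->
            (forall d, Kdef U d -> exists p, is_max_value lt f' p d /\ length p = K U d) ->
            i = gap (c + b) -> i <= K U d).
  { intros U lt f' i Hf' HU Hlt Hshort ->. apply Nat.nlt_ge. intros Hlt'.
    destruct (Hshort d) as (p' & (_ & [u Hu] & _) & Hlen); [eauto using optimal_max_total|].
    destruct (Havoid p') with (u := u) as [H1 H2].
    - apply Nat.lt_le_trans with (1 := proj2 (enc_bits_bounds p')).
      apply Nat.pow_le_mono_r; lia.
    - destruct Hf' as [->| ->]; contradiction. }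
  assert (H1 : gap (c + b) <= K U1 d) by eauto.
  assert (H2 : gap (c + b) <= K U2 d) by eauto.
  assert (HKgap : alpha (K Ust d) <= gap (c + b)).
  { unfold gap. enough (alpha (K Ust d) <= list_sum (map alpha (seq 0 (S (2 * (c + b)))))) by lia.
    apply (le_sum_map alpha), in_seq. pose proof (enc_bits_bounds p). lia. }
  assert (Hin : In d l) by (apply Hl; lia).
  pose proof (le_sum_map (K U1) l d Hin) as Hb. unfold gap, b in H1. lia.
Qed.

(** A bound with constant c would make the gap set for [alpha x = x + c + 1] empty. *)
Lemma not_le_ct_of_gap (g g' h : D -> nat) :
  (forall d, g d <= g' d) ->
  (forall alpha, total_computable alpha -> infinite_set (fun d => g d >= alpha (h d))) ->
  ~ le_ct g' h.
Proof.
  intros Hle Hgap [c Hc]. apply (Hgap (fun x => S (x + c))).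
  - destruct (recursive_S 1 (fun v => nth 0 v 0 + c) ltac:(recursive)) as [e He].
    exists e. intros n y. specialize (He [n] eq_refl). cbn in He. split.
    + intros H. exact (eval_functional _ _ _ _ He H).
    + now intros <-.
  - exists []. intros d Hd. specialize (Hc d). specialize (Hle d). simpl in Hd. lia.
Qed.

(** * Width *)

Definition width_le (st wk : D -> D -> Prop) (k : nat) : Prop :=
  forall l, NoDup l -> (forall x y, In x l -> In y l -> x = y \/ st x y \/ st y x) ->
    (forall x y, In x l -> In y l -> ~ wk x y) -> length l <= k.

Lemma chain_sorted (lt : D -> D -> Prop) (l : list D) :
  (forall x y z, lt x y -> lt y z -> lt x z) -> NoDup l ->
  (forall x y, In x l -> In y l -> x = y \/ lt x y \/ lt y x) ->
  exists l', (forall x, In x l' <-> In x l) /\ StronglySorted lt l'.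
Proof.
  intros Htrans. induction l as [|a l IH]; intros Hnd Hchain.
  - exists []. split; [easy|constructor].
  - inversion Hnd as [|? ? Ha Hnd']; subst.
    destruct IH as (l' & Hl' & Hs); [assumption| |].
    { intros x y Hx Hy. apply Hchain; now right. }
    assert (Hcomp : forall x, In x l' -> lt a x \/ lt x a).
    { intros x Hx. apply Hl' in Hx.
      destruct (Hchain a x (or_introl eq_refl) (or_intror Hx)) as [->|]; easy. }
    assert (Hins : exists l'', (forall x, In x l'' <-> x = a \/ In x l') /\ StronglySorted lt l'').
    { clear - Htrans Hs Hcomp. induction Hs as [|b l' Hs IH Hb].
      - exists [a]. split; [simpl; intuition|repeat constructor].
      - destruct (Hcomp b) as [Hab|Hba]; [now left| |].
        + exists (a :: b :: l'). split; [simpl; intuition|].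
          constructor; [now constructor|]. constructor; [assumption|].
          revert Hb. apply Forall_impl. eauto.
        + destruct IH as (l'' & Hl'' & Hs''); [intros; apply Hcomp; now right|].
          exists (b :: l''). split; [simpl; intros x; rewrite Hl''; intuition|].
          constructor; [assumption|]. apply Forall_forall. intros x Hx.
          apply Hl'' in Hx as [->|Hx]; [assumption|]. rewrite Forall_forall in Hb. auto. }
    destruct Hins as (l'' & Hl'' & Hs''). exists l''. split; [|assumption].
    intros x. rewrite Hl'', Hl'. simpl. intuition.
Qed.

(** Listing a finite st-chain increasingly, whatever the program, is an st-monotone computable
    enumeration. The k wk-monotone functions covering it meet a wk-antichain at most once each. *)
Lemma cond_starstar_width (st wk : D -> D -> Prop) :
  computable_spo rho st -> computable_spo rho wk ->
  cond_starstar rho st wk -> exists k, width_le st wk k.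
Proof.
  intros (Hbij & Hirr & Htrans & _) (_ & Hirrw & _ & _) [k Hk]. exists k.
  intros l Hnd Hchain Hanti.
  destruct (chain_sorted st l Htrans Hnd Hchain) as (l' & Hl' & Hs).
  destruct (map_surjective Hbij l') as [ln <-].
  set (F := fun t : nat => nth t (map S ln) 0).
  assert (HF : forall t x, decode (F t) = Some x <-> nth_error (map rho ln) t = Some x).
  { intros t x. unfold F. clear. revert t. induction ln as [|a ln IH]; intros [|t]; simpl; try easy. }
  destruct (Hk (fun _ t => decode (F t))) as (fs & Hlen & Hfs & Hcover).
  - apply (partial_computable2_decode (fun _ t => F t) Hbij).
    apply recursive_table. recursive.
  - intros p t1 t2 d1 d2 Ht H1 H2. apply HF in H1, H2.
    destruct (Nat.eq_dec t1 t2) as [->|Hne]; [left; congruence|right].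
    assert (Hlt : t1 < t2) by lia. clear - Hs H1 H2 Hlt. revert t1 t2 H1 H2 Hlt.
    induction Hs as [|a m Hs IH Ha]; intros t1 t2 H1 H2 Hlt; [now destruct t1|].
    destruct t2 as [|t2]; [lia|]. simpl in H2. destruct t1 as [|t1].
    + injection H1 as <-. rewrite Forall_forall in Ha. apply Ha. eapply nth_error_In; eauto.
    + apply (IH t1 t2); auto. lia.
  - apply Nat.nlt_ge. intros Hlt.
    destruct (antichain_unreached l (map (fun g => g []) fs)) as (x & Hx & Hnot); try assumption.
    + rewrite length_map. lia.
    + intros g x y t u Hg Hx Hy Ht Hu. apply in_map_iff in Hg as (g' & <- & Hg').
      destruct (Hfs g' Hg') as [_ Hmono].
      destruct (monotone2_comparable wk g' [] t u x y Hmono Ht Hu) as [|[H|H]];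
        [assumption|destruct (Hanti x y Hx Hy H)|destruct (Hanti y x Hy Hx H)].
    + apply Hl', In_nth_error in Hx as [t Ht]. apply HF in Ht.
      destruct (proj1 (Hcover [] x)) as (g & Hg & u & Hu); [eauto|].
      apply (Hnot (g []) u); [now apply (in_map (fun g => g []))|assumption].
Qed.

Lemma width_le_rev (st wk : D -> D -> Prop) k :
  width_le st wk k -> width_le (rev_order st) (rev_order wk) k.
Proof.
  intros H l Hnd Hchain Hanti. apply H; [assumption| |].
  - intros x y Hx Hy. destruct (Hchain x y Hx Hy) as [|[|]]; auto.
  - intros x y Hx Hy. exact (Hanti y x Hy Hx).
Qed.

Lemma cond_star_rev (st wk : D -> D -> Prop) :
  cond_star st wk -> cond_star (rev_order st) (rev_order wk).
Proof.
  intros H k. destruct (H k) as (l & Hlen & Hnd & Hchain & Hanti). exists l.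
  split; [assumption|]. split; [assumption|]. unfold rev_order. split.
  - intros x y Hx Hy Hxy. destruct (Hchain x y Hx Hy Hxy); auto.
  - intros x y Hx Hy. now apply Hanti.
Qed.

(** * On-line chain partition *)

(* Colour c carries the head [get s c] of its chain (option-coded as in [run]) and a level
   [get s (colours k + c)].  There are exactly i colours of level i for i <= k. *)
Definition initial_levels (k : nat) : list nat := flat_map (fun i => repeat i i) (seq 0 (S k)).
Definition colours (k : nat) : nat := length (initial_levels k).

Definition level_count (k s i : nat) : nat :=
  length (filter (fun c => get s (colours k + c) =? i) (seq 0 (colours k))).

(** A chain without a head (code 0) takes any value. A value equal to the head is also taken, since
    dovetailing repeats values. *)
Definition accepts (wkb : nat -> nat -> bool) (z s c : nat) : bool :=
  ((get s c =? 0) || (get s c =? z) || wkb (pred (get s c)) (pred z))%bool.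

Definition level_accepts (wkb : nat -> nat -> bool) (k z s i : nat) : bool :=
  existsb (fun c => (get s (colours k + c) =? i) && accepts wkb z s c)%bool (seq 0 (colours k)).

(** The alternative [k <=? i] ends the search in every state, as a total function requires; under
    the invariant the level found does accept z. *)
Definition chosen_level (wkb : nat -> nat -> bool) (k z s : nat) : nat :=
  least (fun i => level_accepts wkb k z s i || (k <=? i))%bool.

Definition chosen_colour (wkb : nat -> nat -> bool) (k z s : nat) : nat :=
  least (fun c => ((get s (colours k + c) =? chosen_level wkb k z s) && accepts wkb z s c)
                  || (colours k <=? c))%bool.

(* Agarwal and Garg's rule: z goes to a colour of the least level i accepting it, and the
   other colours of level i are exchanged with those of level i - 1.  None of the latter
   accepts z, so the heads of every level remain an antichain. *)
Definition insert (wkb : nat -> nat -> bool) (k z s : nat) : nat :=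
  tabulate (2 * colours k) (fun j =>
    if j <? colours k then (if j =? chosen_colour wkb k z s then z else get s j)
    else if get s j =? chosen_level wkb k z s
         then (if j =? colours k + chosen_colour wkb k z s then get s j else pred (get s j))
         else if S (get s j) =? chosen_level wkb k z s then S (get s j) else get s j).

(** The filter for late values. A value that passes is wk-below no head, because wk is contained in
    st, so refusal by a head means incomparability. The maximum always passes. *)
Definition above_heads (stb : nat -> nat -> bool) (k z s : nat) : bool :=
  forallb (fun c => (get s c =? 0) || (get s c =? z) || stb (pred (get s c)) (pred z))%bool
    (seq 0 (colours k)).

Definition step (stb wkb : nat -> nat -> bool) (k z s : nat) : nat :=
  if z =? 0 then s else if above_heads stb k z s then insert wkb k z s else s.

Lemma recursive_step stb wkb k :
  decidable_rec 2 (fun v => stb (nth 0 v 0) (nth 1 v 0)) ->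
  decidable_rec 2 (fun v => wkb (nth 0 v 0) (nth 1 v 0)) ->
  forall n A B, recursive n A -> recursive n B ->
    recursive n (fun v => step stb wkb k (A v) (B v)).
Proof.
  intros Rst Rwk.
  pose proof (decidable_app2 stb Rst) as Rst'. pose proof (decidable_app2 wkb Rwk) as Rwk'.
  clear Rst Rwk.
  assert (Racc : forall n A B C, recursive n A -> recursive n B -> recursive n C ->
                   decidable_rec n (fun v => accepts wkb (A v) (B v) (C v))).
  { intros. unfold accepts. recursive. }
  assert (Rlv : forall n A B C, recursive n A -> recursive n B -> recursive n C ->
                   decidable_rec n (fun v => level_accepts wkb k (A v) (B v) (C v))).
  { apply (recursive_app3 (fun z s i => Nat.b2n (level_accepts wkb k z s i))).
    unfold level_accepts. recursive. }
  assert (Rlevel : forall n A B, recursive n A -> recursive n B ->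
                   recursive n (fun v => chosen_level wkb k (A v) (B v))).
  { apply recursive_app2. unfold chosen_level. apply recursive_least; [recursive|].
    intros v _. exists k. rewrite Nat.leb_refl. apply Bool.orb_true_r. }
  assert (Rcolour : forall n A B, recursive n A -> recursive n B ->
                   recursive n (fun v => chosen_colour wkb k (A v) (B v))).
  { apply recursive_app2. unfold chosen_colour. apply recursive_least; [recursive|].
    intros v _. exists (colours k). rewrite Nat.leb_refl. apply Bool.orb_true_r. }
  apply recursive_app2. unfold step.
  apply recursive_ifzero; [recursive|recursive|]. apply recursive_if; [|  |recursive].
  - unfold above_heads. recursive.
  - unfold insert. apply recursive_tabulate. recursive.
Qed.

(** Splits off the chosen colour, which keeps its level, from the colours whose levels are
    exchanged. *)
Lemma filter_isolate (P : nat -> bool) (a : nat) (l : list nat) :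
  NoDup l -> In a l ->
  length (filter P l) = Nat.b2n (P a) + length (filter (fun x => P x && negb (x =? a))%bool l).
Proof.
  induction l as [|b l IH]; intros Hnd Ha; [easy|]. inversion Hnd as [|? ? Hb Hnd']; subst.
  simpl. destruct (Nat.eqb_spec b a) as [->|Hne].
  - rewrite Bool.andb_false_r.
    replace (filter (fun x => P x && negb (x =? a))%bool l) with (filter P l).
    + now destruct (P a).
    + apply filter_ext_in. intros x Hx. destruct (Nat.eqb_spec x a) as [->|]; [contradiction|].
      simpl. now rewrite Bool.andb_true_r.
  - destruct Ha as [Ha|Ha]; [contradiction|]. rewrite Bool.andb_true_r.
    specialize (IH Hnd' Ha). destruct (P b); simpl; lia.
Qed.

Lemma initial_state_exists k :
  exists s, (forall c, c < colours k -> get s c = 0) /\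
            (forall i, i <= k -> level_count k s i = i).
Proof.
  destruct (array_exists (repeat 0 (colours k) ++ initial_levels k)) as [s Hs].
  rewrite length_app, repeat_length in Hs. fold (colours k) in Hs. exists s. split.
  - intros c Hc. rewrite Hs by lia. rewrite app_nth1 by (rewrite repeat_length; lia).
    apply nth_repeat.
  - intros i Hi. unfold level_count.
    assert (E : filter (fun c => get s (colours k + c) =? i) (seq 0 (colours k)) =
                filter (fun c => nth c (initial_levels k) 0 =? i) (seq 0 (colours k))).
    { apply filter_ext_in. intros c Hc. apply in_seq in Hc. rewrite Hs by lia.
      rewrite app_nth2; rewrite repeat_length; [|lia]. do 3 f_equal. lia. }
    rewrite E, <- (length_map (fun c => nth c (initial_levels k) 0)).
    rewrite <- (filter_map_swap (fun x => x =? i)). unfold colours. rewrite map_nth_seq.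
    unfold initial_levels.
    assert (Hrep : forall m n, length (filter (fun x => x =? i) (repeat m n)) =
                               if m =? i then n else 0).
    { intros m n. induction n as [|n IH]; simpl; destruct (m =? i); simpl; auto. }
    assert (Hcount : forall n, length (filter (fun x => x =? i)
                       (flat_map (fun i => repeat i i) (seq 0 n))) = if i <? n then i else 0).
    { induction n as [|n IH]; [reflexivity|].
      rewrite seq_S, flat_map_app, filter_app, length_app, IH. simpl. rewrite app_nil_r, Hrep.
      destruct (Nat.ltb_spec i n), (Nat.eqb_spec n i), (Nat.ltb_spec i (S n)); lia. }
    rewrite Hcount. destruct (Nat.ltb_spec i (S k)); lia.
Qed.

(** [V] will be the set of values of one program, pairwise st-comparable, which is what lets
    [width_le] apply to the heads of a level. The antichain clause covers both directions of [wk] by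
    exchanging c and c'. *)
Record invariant (wk : D -> D -> Prop) (V : nat -> Prop) (k s : nat) : Prop := {
  heads_in : forall c y, c < colours k -> get s c = S y -> V y;
  heads_antichain : forall c c' y y', c < colours k -> c' < colours k -> c <> c' ->
    get s (colours k + c) = get s (colours k + c') -> get s c = S y -> get s c' = S y' ->
    y <> y' /\ ~ wk (rho y) (rho y');
  level_counts : forall i, i <= k -> level_count k s i = i
}.

(** After the exchange, level i consists of the chosen colour, with head x, and the i - 1 colours of
    the level below, all of which refused x. The level below receives i - 1 colours from one
    antichain. *)
Lemma insert_correct (st wk : D -> D -> Prop) (wkb : nat -> nat -> bool) (V : nat -> Prop) k s x :
  computable_spo rho st -> (forall d e, wk d e -> st d e) ->
  (forall m n, wkb m n = true <-> wk (rho m) (rho n)) ->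
  (forall m n, V m -> V n -> m = n \/ st (rho m) (rho n) \/ st (rho n) (rho m)) ->
  width_le st wk k -> invariant wk V k s -> V x ->
  (forall c y, c < colours k -> get s c = S y -> y = x \/ st (rho y) (rho x)) ->
  let c0 := chosen_colour wkb k (S x) s in
  c0 < colours k /\ accepts wkb (S x) s c0 = true /\
  (forall c, c < colours k ->
     get (insert wkb k (S x) s) c = if c =? c0 then S x else get s c) /\
  invariant wk V k (insert wkb k (S x) s).
Proof.
  intros (Hbij & Hirr & Htrans & _) Hext Hwkb Hcomp Hwidth [HV Hanti Hcount] Hx Habove c0.
  set (C := colours k) in *. set (i0 := chosen_level wkb k (S x) s).
  assert (Hrefuse : forall c, accepts wkb (S x) s c = false ->
            exists y, get s c = S y /\ y <> x /\ ~ wk (rho y) (rho x)).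
  { intros c. unfold accepts. destruct (get s c) as [|y]; [discriminate|]. cbn. intros H.
    apply Bool.orb_false_iff in H as [H1 H2]. apply Nat.eqb_neq in H1. exists y.
    split; [reflexivity|]. split; [assumption|]. rewrite <- Hwkb, H2. discriminate. }
  assert (Hlevel : forall i, level_accepts wkb k (S x) s i = true <->
            exists c, c < C /\ get s (C + c) = i /\ accepts wkb (S x) s c = true).
  { intros i. unfold level_accepts. fold C. rewrite existsb_seq.
    setoid_rewrite Bool.andb_true_iff. setoid_rewrite Nat.eqb_eq. reflexivity. }
  (* If all k colours of level k refused x, their heads and x would be k + 1 elements forming a
     wk-antichain inside an st-chain. *)
  assert (Htop : level_accepts wkb k (S x) s k = true).
  { apply Bool.not_false_is_true. intros Hno.
    assert (Hno' : forall c, c < C -> get s (C + c) = k ->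
              exists y, get s c = S y /\ y <> x /\ ~ wk (rho y) (rho x)).
    { intros c Hc Hk. apply Hrefuse. apply Bool.not_true_is_false. intros Hacc.
      enough (level_accepts wkb k (S x) s k = true) by congruence. apply Hlevel. eauto. }
    set (l := filter (fun c => get s (C + c) =? k) (seq 0 C)).
    assert (Hl : forall c, In c l <-> c < C /\ get s (C + c) = k).
    { intros c. unfold l. rewrite filter_In, in_seq, Nat.eqb_eq. intuition lia. }
    set (ys := x :: map (fun c => pred (get s c)) l).
    assert (Hys : forall y, In y ys -> y = x \/ exists c, c < C /\ get s (C + c) = k /\ get s c = S y).
    { intros y [Hy|Hy]; [now left|right]. apply in_map_iff in Hy as (c & <- & Hc).
      apply Hl in Hc as [Hc Hk]. destruct (Hno' c Hc Hk) as (y & Hy & _).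
      exists c. rewrite Hy. auto. }
    assert (Hnd : NoDup (map rho ys)).
    { apply FinFun.Injective_map_NoDup; [exact (proj1 Hbij)|]. constructor.
      - intros Hin. apply in_map_iff in Hin as (c & E & Hc). apply Hl in Hc as [Hc Hk].
        destruct (Hno' c Hc Hk) as (y & Hy & Hne & _). rewrite Hy in E. now apply Hne.
      - apply NoDup_map_NoDup_ForallPairs; [|apply NoDup_filter, seq_NoDup].
        intros c c' Hc Hc' E. apply Hl in Hc as [Hc Hk], Hc' as [Hc' Hk'].
        destruct (Nat.eq_dec c c') as [|Hne]; [assumption|exfalso].
        destruct (Hno' c Hc Hk) as (y & Hy & _), (Hno' c' Hc' Hk') as (y' & Hy' & _).
        rewrite Hy, Hy' in E.
        destruct (Hanti c c' y y' Hc Hc' Hne ltac:(congruence) Hy Hy') as [Hyy _]. now apply Hyy. }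
    assert (HVys : forall y, In y ys -> V y).
    { intros y Hy. destruct (Hys y Hy) as [->|(c & Hc & _ & E)]; eauto. }
    specialize (Hwidth (map rho ys) Hnd).
    assert (Hlen : length (map rho ys) = S k).
    { unfold ys. simpl. rewrite !length_map. f_equal. exact (Hcount k (le_n k)). }
    rewrite Hlen in Hwidth. enough (S k <= k) by lia. apply Hwidth.
    - intros d e Hd He. apply in_map_iff in Hd as (m & <- & Hm), He as (n & <- & Hn).
      destruct (Hcomp m n) as [->|]; auto.
    - intros d e Hd He Hde. apply in_map_iff in Hd as (m & <- & Hm), He as (n & <- & Hn).
      destruct (Hys m Hm) as [->|(c & Hc & Hk & Ec)], (Hys n Hn) as [->|(c' & Hc' & Hk' & Ec')].
      + exact (Hirr _ (Hext _ _ Hde)).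
      + destruct (Habove c' n Hc' Ec') as [->|H].
        * exact (Hirr _ (Hext _ _ Hde)).
        * exact (Hirr _ (Htrans _ _ _ H (Hext _ _ Hde))).
      + destruct (Hno' c Hc Hk) as (y & Hy & _ & Hnwk). congruence.
      + destruct (Nat.eq_dec c c') as [->|Hne].
        * assert (m = n) as -> by congruence. exact (Hirr _ (Hext _ _ Hde)).
        * now destruct (Hanti c c' m n Hc Hc' Hne ltac:(congruence) Ec Ec'). }
  assert (Hi0_ex : exists i, (level_accepts wkb k (S x) s i || (k <=? i))%bool = true)
    by (exists k; now rewrite Htop).
  assert (Hi0 : level_accepts wkb k (S x) s i0 = true /\ i0 <= k).
  { destruct (Nat.le_gt_cases i0 k) as [Hle|Hgt].
    - split; [|assumption]. destruct (Nat.eq_dec i0 k) as [->|Hne]; [assumption|].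
      pose proof (least_spec _ Hi0_ex) as H. cbv beta in H.
      change (least _) with i0 in H.
      apply Bool.orb_true_iff in H as [H|H]; [assumption|]. apply Nat.leb_le in H. lia.
    - pose proof (least_minimal _ k Hi0_ex Hgt) as H. cbv beta in H.
      now rewrite Htop in H. }
  destruct Hi0 as [Hi0 Hi0k].
  assert (Hbelow : forall i, i < i0 -> level_accepts wkb k (S x) s i = false).
  { intros i Hi. pose proof (least_minimal _ i Hi0_ex Hi) as H.
    now apply Bool.orb_false_iff in H. }
  assert (Hc0 : c0 < C /\ get s (C + c0) = i0 /\ accepts wkb (S x) s c0 = true).
  { apply Hlevel in Hi0 as (c & Hc & Hci & Hacc).
    assert (Hex : exists c, (((get s (C + c) =? i0) && accepts wkb (S x) s c)
                             || (C <=? c))%bool = true).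
    { exists c. now rewrite Hci, Nat.eqb_refl, Hacc. }
    assert (Hle : c0 <= c).
    { apply Nat.nlt_ge. intros Hlt. pose proof (least_minimal _ c Hex Hlt) as H. cbv beta in H.
      now rewrite Hci, Nat.eqb_refl, Hacc in H. }
    split; [lia|]. pose proof (least_spec _ Hex) as H. cbv beta in H.
    change (least _) with c0 in H.
    apply Bool.orb_true_iff in H as [H|H]; [|apply Nat.leb_le in H; lia].
    apply Bool.andb_true_iff in H as [H1 H2]. apply Nat.eqb_eq in H1. auto. }
  destruct Hc0 as (Hc0 & Hc0i & Hc0a).
  (* Level 0 has no colours, so [pred i0] is a genuine level to exchange with. *)
  assert (Hpos : 0 < i0).
  { destruct (Nat.eq_0_gt_0_cases i0) as [E|]; [exfalso|assumption].
    specialize (Hcount 0 (Nat.le_0_l k)). unfold level_count in Hcount. fold C in Hcount.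
    apply length_zero_iff_nil in Hcount.
    enough (H : In c0 (filter (fun c => get s (C + c) =? 0) (seq 0 C)))
      by (rewrite Hcount in H; destruct H).
    apply filter_In. split; [apply in_seq; lia|]. apply Nat.eqb_eq. congruence. }
  set (s' := insert wkb k (S x) s).
  assert (Hhead : forall c, c < C -> get s' c = if c =? c0 then S x else get s c).
  { intros c Hc. unfold s', insert. fold C c0. rewrite get_tabulate by lia.
    destruct (Nat.ltb_spec c C); [reflexivity|lia]. }
  assert (Hlev : forall c, c < C -> get s' (C + c) =
            if c =? c0 then i0
            else if get s (C + c) =? i0 then pred i0
            else if S (get s (C + c)) =? i0 then i0 else get s (C + c)).
  { intros c Hc. unfold s', insert. fold C c0 i0. rewrite get_tabulate by lia.
    destruct (Nat.ltb_spec (C + c) C); [lia|].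
    destruct (Nat.eqb_spec c c0) as [->|Hne].
    - now rewrite Hc0i, !Nat.eqb_refl.
    - destruct (Nat.eqb_spec (get s (C + c)) i0) as [->|].
      + destruct (Nat.eqb_spec (C + c) (C + c0)); [lia|reflexivity].
      + destruct (Nat.eqb_spec (S (get s (C + c))) i0); [assumption|reflexivity]. }
  (* A colour other than [c0] now at level [i0] was at the level below, which refused x by
     minimality of [i0]; the filter excludes the other direction of [wk]. *)
  assert (Hnew : forall c y, c < C -> c <> c0 -> get s' (C + c) = i0 -> get s c = S y ->
            x <> y /\ ~ wk (rho x) (rho y) /\ ~ wk (rho y) (rho x)).
  { intros c y Hc Hne Hi Hy. rewrite Hlev in Hi by assumption.
    destruct (Nat.eqb_spec c c0); [contradiction|].
    destruct (Nat.eqb_spec (get s (C + c)) i0); [lia|].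
    destruct (Nat.eqb_spec (S (get s (C + c))) i0) as [Hs|]; [|contradiction].
    destruct (Hrefuse c) as (y' & Hy' & Hyx & Hnwk).
    { apply Bool.not_true_is_false. intros Hacc.
      enough (H : level_accepts wkb k (S x) s (get s (C + c)) = true)
        by (rewrite Hbelow in H; [discriminate|lia]).
      apply Hlevel. eauto. }
    assert (y' = y) as -> by congruence. split; [auto|]. split; [|assumption].
    intros H. destruct (Habove c y Hc Hy) as [E|H']; [contradiction|].
    exact (Hirr _ (Htrans _ _ _ H' (Hext _ _ H))). }
  split; [assumption|]. split; [assumption|]. split; [exact Hhead|]. split.
  - intros c y Hc E. rewrite Hhead in E by assumption.
    destruct (c =? c0); [injection E as <-; assumption|eauto].
  - fold C. intros c c' y y' Hc Hc' Hne Hl Hy Hy'.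
    rewrite Hhead in Hy, Hy' by assumption.
    destruct (Nat.eqb_spec c c0) as [->|Hcc0], (Nat.eqb_spec c' c0) as [->|Hcc0'].
    + contradiction.
    + injection Hy as <-.
      assert (Hi : get s' (C + c') = i0) by (rewrite <- Hl, Hlev, Nat.eqb_refl; auto).
      destruct (Hnew c' y' Hc' Hcc0' Hi Hy') as (? & ? & ?). auto.
    + injection Hy' as <-.
      assert (Hi : get s' (C + c) = i0) by (rewrite Hl, Hlev, Nat.eqb_refl; auto).
      destruct (Hnew c y Hc Hcc0 Hi Hy) as (? & ? & ?). auto.
    + apply (Hanti c c'); try assumption.
      rewrite !Hlev in Hl by assumption. revert Hl.
      destruct (Nat.eqb_spec c c0), (Nat.eqb_spec c' c0); try contradiction.
      repeat match goal with |- context [?a =? ?b] => destruct (Nat.eqb_spec a b) end; lia.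
  - intros i Hi. unfold level_count. fold C.
    assert (Hin : In c0 (seq 0 C)) by (apply in_seq; lia).
    rewrite (filter_isolate _ c0) by (apply seq_NoDup || exact Hin).
    (* [j] is the former level of the colours other than [c0] that are now at level i. *)
    set (j := if i =? i0 then pred i0 else if S i =? i0 then i0 else i).
    assert (Hj : j <= k).
    { unfold j. destruct (Nat.eqb_spec i i0), (Nat.eqb_spec (S i) i0); lia. }
    assert (E := Hcount j Hj). unfold level_count in E. fold C in E.
    rewrite (filter_isolate _ c0) in E by (apply seq_NoDup || exact Hin).
    replace (filter (fun c => (get s' (C + c) =? i) && negb (c =? c0))%bool (seq 0 C))
      with (filter (fun c => (get s (C + c) =? j) && negb (c =? c0))%bool (seq 0 C)).
    + rewrite Hlev, Nat.eqb_refl by assumption. rewrite Hc0i in E. revert E. unfold j.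
      repeat match goal with |- context [if ?a =? ?b then _ else _] =>
               destruct (Nat.eqb_spec a b) end;
        repeat match goal with |- context [Nat.b2n (?a =? ?b)] =>
               destruct (Nat.eqb_spec a b) end; cbn [Nat.b2n]; lia.
    + apply filter_ext_in. intros c Hc. apply in_seq in Hc.
      destruct (Nat.eqb_spec c c0) as [|Hne]; [now rewrite !Bool.andb_false_r|].
      rewrite !Bool.andb_true_r, Hlev by lia. unfold j.
      destruct (Nat.eqb_spec c c0); [contradiction|].
      repeat match goal with |- context [if ?a =? ?b then _ else _] =>
               destruct (Nat.eqb_spec a b) end;
        repeat match goal with |- context [?a =? ?b] => destruct (Nat.eqb_spec a b) end;
        (reflexivity || lia).
Qed.

Lemma le_ct_of_width (st wk : D -> D -> Prop) Ust Uwk k :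
  computable_spo rho st -> computable_spo rho wk -> (forall d e, wk d e -> st d e) ->
  optimal_max rho st Ust -> optimal_max rho wk Uwk -> width_le st wk k ->
  le_ct (K Uwk) (K Ust).
Proof.
  intros Hst Hwk Hext HUst HUwk Hwidth.
  destruct (computable_spo_decidable st Hst) as (stb & Rstb & Hstb).
  destruct (computable_spo_decidable wk Hwk) as (wkb & Rwkb & Hwkb).
  destruct (optimal_max_shortest st Ust HUst) as (f & Hf & Hmono & Hshort).
  destruct (partial_computable2_stages f Hf) as (F & RF & HF).
  destruct (initial_state_exists k) as (s0 & Hs0 & Hcount0).
  set (C := colours k) in *.
  (* Dovetailing: t codes a budget and an argument, so every value defined by [f] appears at some
     time. *)
  set (input := fun q t => F (unpair_l t) q (unpair_r t)).
  set (state := fun q t => nat_rect (fun _ => nat) s0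
                             (fun t s => step stb wkb k (input q t) s) t).
  assert (Rstate : forall n A B, recursive n A -> recursive n B ->
                     recursive n (fun v => state (A v) (B v))).
  { pose proof (recursive_app3 F RF) as RF'. pose proof (recursive_step stb wkb k Rstb Rwkb) as Rs.
    clear RF Rstb Rwkb.
    apply recursive_app2. unfold state, input.
    apply (recursive_prec 2 (fun _ => s0) (fun t s v =>
      step stb wkb k (F (unpair_l t) (nth 0 v 0) (unpair_r t)) s) (fun v => nth 1 v 0)); recursive. }
  set (V := fun p y => exists u, f p u = Some (rho y)).
  assert (HV : forall p t y, input (enc_bits p) t = S y -> V p y).
  { intros p t y H. exists (unpair_r t). apply HF. eauto. }
  assert (Hcomp : forall p m n, V p m -> V p n ->
            m = n \/ st (rho m) (rho n) \/ st (rho n) (rho m)).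
  { intros p m n [t Ht] [u Hu].
    destruct (monotone2_comparable st f p t u _ _ Hmono Ht Hu) as [E|]; [left|now right].
    now apply (proj1 (proj1 Hst)). }
  assert (Habove : forall s x, above_heads stb k (S x) s = true <->
            forall c y, c < C -> get s c = S y -> y = x \/ st (rho y) (rho x)).
  { intros s x. unfold above_heads. fold C. rewrite forallb_seq.
    setoid_rewrite Bool.orb_true_iff. setoid_rewrite Bool.orb_true_iff.
    setoid_rewrite Nat.eqb_eq. setoid_rewrite Hstb. split.
    - intros H c y Hc E. specialize (H c Hc). rewrite E in H.
      destruct H as [[H|H]|H]; [discriminate|left; congruence|now right].
    - intros H c Hc. destruct (get s c) as [|y] eqn:E; [auto|].
      destruct (H c y Hc E) as [->|]; auto. }
  assert (Hinv : forall p t, invariant wk (V p) k (state (enc_bits p) t)).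
  { intros p. induction t as [|t IH].
    - simpl. split; [| |assumption]; fold C.
      + intros c y Hc. now rewrite Hs0.
      + intros c c' y y' Hc _ _ _. now rewrite Hs0.
    - unfold state. cbn [nat_rect]. fold (state (enc_bits p) t). unfold step.
      destruct (input (enc_bits p) t) as [|x] eqn:Ex; [assumption|]. cbn [Nat.eqb].
      destruct (above_heads stb k (S x) (state (enc_bits p) t)) eqn:Ea; [|assumption].
      eapply (insert_correct st wk); eauto. exact (proj1 (Habove _ _) Ea). }
  (* Once a colour has a head it keeps one, and the head only moves up in [wk]; this makes each
     colour a wk-monotone enumeration. *)
  assert (Hstep : forall p t c y, c < C -> get (state (enc_bits p) t) c = S y ->
            exists z, get (state (enc_bits p) (S t)) c = S z /\ (y = z \/ wk (rho y) (rho z))).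
  { intros p t c y Hc E. unfold state. cbn [nat_rect]. fold (state (enc_bits p) t). unfold step.
    destruct (input (enc_bits p) t) as [|x] eqn:Ex; [eauto|]. cbn [Nat.eqb].
    destruct (above_heads stb k (S x) (state (enc_bits p) t)) eqn:Ea; [|eauto].
    destruct (insert_correct st wk wkb (V p) k (state (enc_bits p) t) x)
      as (_ & Hacc & Hheads & _); eauto; [exact (proj1 (Habove _ _) Ea)|].
    rewrite Hheads by assumption. destruct (Nat.eqb_spec c (chosen_colour wkb k (S x)
      (state (enc_bits p) t))) as [->|]; [|eauto].
    exists x. split; [reflexivity|]. unfold accepts in Hacc. rewrite E in Hacc. cbn in Hacc.
    apply Bool.orb_true_iff in Hacc as [H|H]; [left; now apply Nat.eqb_eq|right; now apply Hwkb]. }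
  set (g := fun c p t => decode (get (state (enc_bits p) t) c)).
  assert (Hg : forall c p t e, g c p t = Some e <->
            exists y, get (state (enc_bits p) t) c = S y /\ rho y = e).
  { intros c p t e. unfold g. destruct (get _ c) as [|y]; simpl; split.
    - discriminate.
    - now intros (y & H & _).
    - intros [= <-]. eauto.
    - intros (y' & [= ->] & <-). reflexivity. }
  assert (Hgmono : forall c, c < C -> monotone2 wk (g c)).
  { intros c Hc p t1 t2 d1 d2 Ht H1 H2.
    apply Hg in H1 as (y1 & H1 & <-), H2 as (y2 & H2 & <-).
    assert (H : forall t, exists z, get (state (enc_bits p) (t + t1)) c = S z /\
                  (rho y1 = rho z \/ wk (rho y1) (rho z))).
    { induction t as [|t (z & Hz & Hyz)]; [eauto|].
      destruct (Hstep p (t + t1) c z Hc Hz) as (z' & Hz' & Hzz'). exists z'.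
      split; [exact Hz'|].
      destruct Hyz as [E|Hyz], Hzz' as [<-|Hzz']; try rewrite E; auto.
      right. exact (proj1 (proj2 (proj2 Hwk)) _ _ _ Hyz Hzz'). }
    destruct (H (t2 - t1)) as (z & Hz & Hyz). replace (t2 - t1 + t1) with t2 in Hz by lia.
    now assert (z = y2) as -> by congruence. }
  assert (Hgmax : forall p d, is_max_value st f p d ->
            exists c, c < C /\ is_max_value wk (g c) p d).
  { intros p d ([l Hl] & [u Hu] & Hmax). destruct (proj2 (proj1 Hst) d) as [x <-].
    destruct (proj1 (HF p u x) Hu) as [w Hw].
    set (t := Cantor.to_nat (w, u)).
    assert (Ex : input (enc_bits p) t = S x).
    { unfold input, unpair_l, unpair_r, t. now rewrite Cantor.cancel_of_to. }
    assert (Hle : forall c y t, c < C -> get (state (enc_bits p) t) c = S y ->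
              y = x \/ st (rho y) (rho x)).
    { intros c y t' Hc E. destruct (heads_in _ _ _ _ (Hinv p t') c y Hc E) as [u' Hu'].
      destruct (Hmax u' _ Hu') as [E'|]; [left|now right]. now apply (proj1 (proj1 Hst)). }
    (* All heads are values of [f] on p, hence st-below or equal to the maximum x, so x passes the
       filter when it appears. *)
    assert (Ea : above_heads stb k (S x) (state (enc_bits p) t) = true)
      by (apply Habove; eauto).
    destruct (insert_correct st wk wkb (V p) k (state (enc_bits p) t) x)
      as (Hc0 & _ & Hheads & _); eauto.
    set (c0 := chosen_colour wkb k (S x) (state (enc_bits p) t)) in *. fold C in Hc0.
    exists c0. split; [assumption|].
    assert (Hatt : g c0 p (S t) = Some (rho x)).
    { apply Hg. exists x. split; [|reflexivity]. unfold state. cbn [nat_rect].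
      fold (state (enc_bits p) t). unfold step. rewrite Ex. cbn [Nat.eqb]. rewrite Ea, Hheads
        by assumption. now rewrite Nat.eqb_refl. }
    split; [|split; [eauto|]].
    - exists l. intros e [t' Ht']. apply Hg in Ht' as (y & Hy & <-). apply Hl.
      exact (heads_in _ _ _ _ (Hinv p t') c0 y Hc0 Hy).
    - intros t' e He.
      (* Values of one colour are wk-comparable with x, and being wk-above x would contradict the
         st-maximality of x. *)
      destruct (monotone2_comparable wk (g c0) p t' (S t) e (rho x) (Hgmono c0 Hc0) He Hatt)
        as [|[|H]]; [now left|now right|].
      apply Hg in He as (y & Hy & <-). left.
      destruct (Hle c0 y t' Hc0 Hy) as [->|H']; [reflexivity|].
      destruct Hst as (_ & Hirr & Htrans & _).
      destruct (Hirr _ (Htrans _ _ _ H' (Hext _ _ H))). }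
  (* Each colour is a separate machine with its own constant; their sum serves whichever colour
     reaches the maximum. *)
  assert (Hbound : exists b, forall c p d, c < C -> is_max_value wk (g c) p d ->
            K Uwk d <= length p + b).
  { enough (H : forall m, m <= C -> exists b, forall c p d, c < m -> is_max_value wk (g c) p d ->
                  K Uwk d <= length p + b) by exact (H C (le_n C)).
    induction m as [|m IH]; intros Hm; [exists 0; lia|].
    destruct IH as [b Hb]; [lia|].
    destruct (optimal_max_bound wk Uwk (g m)) as [b' Hb']; try assumption.
    - apply (partial_computable2_decode (fun q t => get (state q t) m) (proj1 Hst)). recursive.
    - apply Hgmono. lia.
    - exists (b + b'). intros c p d Hc Hd. assert (c < m \/ c = m) as [H| ->] by lia.
      + specialize (Hb c p d H Hd). lia.
      + destruct (Hb' p d Hd). lia. }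
  destruct Hbound as [b Hb]. exists b. intros d.
  destruct (Hshort d) as (p & Hp & <-); [eauto using optimal_max_total|].
  destruct (Hgmax p d Hp) as (c & Hc & Hd). eauto.
Qed.

End Values.

Theorem mainTheorem3 (D : Type) (rho : nat -> D) (st wk : D -> D -> Prop)
  (Hst : computable_spo rho st) (Hwk : computable_spo rho wk)
  (Hext : forall d e, wk d e -> st d e)
  (Ust_max Ust_min Uwk_max Uwk_min : list bool -> option D)
  (Ost_max : optimal_max rho st Ust_max)
  (Ost_min : optimal_max rho (rev_order st) Ust_min)
  (Owk_max : optimal_max rho wk Uwk_max)
  (Owk_min : optimal_max rho (rev_order wk) Uwk_min) :
  (cond_star st wk ->
     lt_ct (K Ust_max) (K Uwk_max) /\
     lt_ct (K Ust_min) (K Uwk_min) /\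
     (forall alpha : nat -> nat, total_computable alpha ->
        infinite_set (fun d => Nat.min (K Uwk_min d) (K Uwk_max d) >= alpha (K Ust_max d)) /\
        infinite_set (fun d => Nat.min (K Uwk_min d) (K Uwk_max d) >= alpha (K Ust_min d)))) /\
  (cond_starstar rho st wk ->
     eq_ct (K Ust_min) (K Uwk_min) /\ eq_ct (K Ust_max) (K Uwk_max)).
Proof.
  pose proof (computable_spo_rev rho st Hst) as Hst'.
  pose proof (computable_spo_rev rho wk Hwk) as Hwk'.
  assert (Hext' : forall d e, rev_order wk d e -> rev_order st d e) by (intros d e; apply Hext).
  pose proof (le_ct_extension rho st wk _ _ Hst Hwk Hext Ost_max Owk_max) as Hmax.
  pose proof (le_ct_extension rho _ _ _ _ Hst' Hwk' Hext' Ost_min Owk_min) as Hmin.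
  split.
  - intros Hstar.
    assert (Gmax : forall alpha, total_computable alpha ->
      infinite_set (fun d => Nat.min (K Uwk_min d) (K Uwk_max d) >= alpha (K Ust_max d)))
      by (intros alpha; now apply (infinite_complexity_gap rho st wk)).
    assert (Gmin : forall alpha, total_computable alpha ->
      infinite_set (fun d => Nat.min (K Uwk_min d) (K Uwk_max d) >= alpha (K Ust_min d))).
    { intros alpha Ha [l Hl].
      (* With both orders reversed, the two wk-complexities change roles: the double reversal of
         [wk] is convertible to [wk], so [Uwk_max] is optimal for it. *)
      apply (infinite_complexity_gap rho _ _ _ _ Uwk_max alpha Hst' Hwk'
               (cond_star_rev st wk Hstar) Ost_min Owk_min Owk_max Ha).
      exists l. intros d Hd. apply Hl. now rewrite Nat.min_comm. }
    split; [|split]; [split; [exact Hmax|]|split; [exact Hmin|]|auto].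
    + exact (not_le_ct_of_gap _ _ _ (fun d => Nat.le_min_r _ _) Gmax).
    + exact (not_le_ct_of_gap _ _ _ (fun d => Nat.le_min_l _ _) Gmin).
  - intros Hss. destruct (cond_starstar_width rho st wk Hst Hwk Hss) as [k Hk].
    split; split; try assumption.
    + exact (le_ct_of_width rho _ _ _ _ k Hst' Hwk' Hext' Ost_min Owk_min
               (width_le_rev st wk k Hk)).
    + exact (le_ct_of_width rho st wk _ _ k Hst Hwk Hext Ost_max Owk_max Hk).
Qed.
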